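(* Let $n\ge 2$ be an integer and let $c = r_c e^{2\pi i\phi}\in\mathbb{C}$ with $0<r_c=|c|<1$ and $\phi\in\mathbb{R}$. With the notation $\Lambda_{n,c}$, $W_{n,c,\theta}$, $E_{n,c,\theta}$ and $F_{2,|c|^b}$ defined in the context, the following hold. (1) If $\phi\notin\mathbb{Q}$, then: (a) For all $\theta\in[0,1]$, $|W_{n,c,\theta}| = |E_{n,c,\theta}|\in\{1,2\}$. (b) The set of $\theta\in[0,1]$ such that $|W_{n,c,\theta}|=1$ is dense in $[0,1]$. (c) The set of $\theta\in[0,1]$ such that $|W_{n,c,\theta}|=2$ is dense in $[0,1]$. (d) $\Lambda_{n,c}$ is not convex. (2) If $\phi\in\mathbb{Q}$ with $\phi=p/q$ in lowest terms ($q\ge 1$), let $b$ be the positive integer such that $bn=\mathrm{lcm}(n,q)$, and let $$\Theta=\left\{\ell\phi+\frac{m}{n}+\frac{1}{2n} \;:\; 0\le \ell\le b-1,\ 0\le m\le n-1\right\},$$ where angles are taken modulo $1$. Then: (a) For $\theta\in\Theta$, the set $E_{n,c,\theta}$ is itself the limit set of an iterated function system with two generators which is conjugate to $F_{2,|c|^b}$. That is, $E_{n,c,\theta}$ is a Cantor set with dilation factor $|c|^b$ (or an interval, i.e. a line segment, if $|c|^b\ge 1/2$). (b) For $\theta\notin\Theta$, $|W_{n,c,\theta}|=|E_{n,c,\theta}|=1$. (c) The convex hull of $\Lambda_{n,c}$ is a polygon with $nb$ sides, at the angles in $\Theta$ (in the degenerate case $nb=2$, the two-sided polygon is a line segment counted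 as two sides). (d) If $\Lambda_{n,c}$ is convex, then $|c|\ge 2^{-1/b}$.
   Context: For an integer $n\ge 2$ and $c\in\mathbb{C}$ with $|c|<1$, put $\xi=e^{2\pi i/n}$ and let $F_{n,c}$ be the iterated function system generated by the maps $f_j:\mathbb{C}\to\mathbb{C}$, $f_j(z)=cz+\xi^j$, $j=0,\dots,n-1$. (Thus $F_{2,r}$ is generated by $z\mapsto rz+1$ and $z\mapsto rz-1$.) Its limit set $\Lambda_{n,c}$ is the unique nonempty compact set $\Lambda\subset\mathbb{C}$ with $\Lambda=\bigcup_{j=0}^{n-1}f_j(\Lambda)$; the limit set of any iterated function system of finitely many contractions is defined in the same way. Two iterated function systems on $\mathbb{C}$ are conjugate if an invertible affine map $z\mapsto\alpha z+\beta$ ($\alpha\ne 0$) of $\mathbb{C}$ conjugates the generators of one to the generators of the other. Let $F_{n,c}^\infty$ be the set of infinite words $f=(j_0,j_1,\dots)$ with letters in $\{0,\dots,n-1\}$, and let $\pi:F_{n,c}^\infty\to\mathbb{C}$ be $\pi(f)=\lim_{m\to\infty}(f_{j_0}\circ\cdots\circ f_{j_m})(z)=\sum_{k=0}^\infty c^k\xi^{j_k}$ (independent of $z$). The image of $\pi$ is $\Lambda_{n,c}$. All angles are normalized to lie in $[0,1]$ and are taken modulo $1$: the angle $\theta$ is the argument of $e^{2\pi i\theta}$. For $\theta\in[0,1]$ let $v_\theta:\mathbb{C}\to\mathbb{R}$ be the real linear function given by the standard real inner product with $e^{2\pi i\theta}$, i.e. $v_\theta(z)=\mathrm{Re}(z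 e^{-2\pi i\theta})$. The set of extreme points at angle $\theta$ is $$E_{n,c,\theta}=\{p\in\Lambda_{n,c}: v_\theta(p)=\max_{\Lambda_{n,c}} v_\theta\},$$ and the set of extreme words at angle $\theta$ is $W_{n,c,\theta}=\{f\in F_{n,c}^\infty:\pi(f)\in E_{n,c,\theta}\}$. (So ''extreme'' here means lying on a supporting line of $\Lambda_{n,c}$, not extreme in the usual sense of convexity.) A side of a polygon is at angle $\theta$ if its outward normal is $e^{2\pi i\theta}$. *)

(* Defs.v *)
From HB Require Import structures.
From mathcomp Require Import all_boot all_order all_algebra perm.
From mathcomp Require Import complex.
From mathcomp Require Import all_classical all_reals all_analysis.

Set Implicit Arguments.
Unset Strict Implicit.
Unset Printing Implicit Defensive.

Import Order.TTheory GRing.Theory Num.Theory.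
Import numFieldNormedType.Exports.

Local Open Scope classical_set_scope.
Local Open Scope card_scope.
Local Open Scope complex_scope.
Local Open Scope ring_scope.

Export Normc.

(** The topology of R[i] is that of its norm, as for any [numFieldType]. *)
HB.instance Definition _ (R : realType) := NormedModule.copy R[i] (R[i]^o).

Section Defs.
Context {R : realType}.
Local Notation C := R[i].

(** Angles are measured in turns: [cexp t] is exp(2 pi i t). *)
Definition cexp (t : R) : C := cos (2 * pi * t) +i* sin (2 * pi * t).

(** An iterated function system is given by its family of generators. *)
Definition is_limit_set k (F : 'I_k -> C -> C) (L : set C) : Prop :=
  [/\ L !=set0, compact L & L = \bigcup_j (F j @` L)].

(** The limit set of [F]; existence and uniqueness hold for contractions
    (the value is [set0] if no set satisfies [is_limit_set F]). *)
Definition limit_set k (F : 'I_k -> C -> C) : set C :=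
  xget set0 [set L | is_limit_set F L].

Definition conjugate_ifs k (F G : 'I_k -> C -> C) : Prop :=
  exists (a b : C) (s : {perm 'I_k}),
    a != 0 /\ forall i z, a * F i z + b = G (s i) (a * z + b).

Definition word_map k (F : 'I_k -> C -> C) (w : nat -> 'I_k) (m : nat) : C -> C :=
  \big[(fun f g : C -> C => f \o g)/idfun]_(i < m) F (w i).

(** For contractions the limit does not depend on the base point, here 0. *)
Definition coding k (F : 'I_k -> C -> C) (w : nat -> 'I_k) : C :=
  limn (fun m : nat => word_map F w m 0).

Definition root_ifs (n : nat) (c : C) (j : 'I_n) (z : C) : C :=
  c * z + cexp n%:R^-1 ^+ j.

Lemma word_map_root_ifs n c (w : nat -> 'I_n) m z :
  word_map (root_ifs c) w m z =
  \sum_(k < m) c ^+ k * cexp n%:R^-1 ^+ w k + c ^+ m * z.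
Proof.
rewrite /word_map; elim: m w z => [|m IH] w z.
  by rewrite !big_ord0 add0r expr0 mul1r.
rewrite !big_ord_recl /= /root_ifs expr0 mul1r.
under eq_bigr do rewrite /bump /= add1n.
rewrite (IH (fun k => w k.+1)) mulrDr mulr_sumr addrC addrA exprS mulrA.
by congr (_ + _ + _); apply: eq_bigr => k _; rewrite /bump /= add1n exprS mulrA.
Qed.

Definition Lambda (n : nat) (c : C) : set C := limit_set (@root_ifs n c).

Definition v (theta : R) (z : C) : R := complex.Re (z * cexp (- theta)).

(** The points of [A] where the restriction of [v theta] to [A] attains its
    maximum. *)
Definition extreme_at (A : set C) (theta : R) : set C :=
  [set p | A p /\ forall q, A q -> v theta q <= v theta p].

Definition E (n : nat) (c : C) (theta : R) : set C :=
  extreme_at (Lambda n c) theta.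

Definition W (n : nat) (c : C) (theta : R) : set (nat -> 'I_n) :=
  [set w | E n c theta (coding (root_ifs c) w)].

(** Real convexity: [Rcomplex R] is R[i] as a module over R. *)
Definition convex (A : set C) : Prop := @convex_set R (Rcomplex R) A.

Definition convex_hull (A : set C) : set C := smallest convex A.

Definition segment (x y : C) : set C :=
  [set (1 - t)%:C * x + t%:C * y | t in (`[0, 1] : set R)].

(** Nondegenerate (convex) polygons. *)
Definition polygon (P : set C) : Prop :=
  (exists V : set C, finite_set V /\ P = convex_hull V) /\ P° !=set0.

(** Angles, represented in [0, 1), of the outward normals of the sides of [P].
    Distinct sides of a polygon have distinct outward normals, so this set
    counts the sides; a line segment has two side angles, half a turn apart. *)
Definition side_angles (P : set C) : set R :=
  [set theta | 0 <= theta < 1 /\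
     exists x y, x != y /\ extreme_at P theta = segment x y].

Definition is_cantor_set (A : set C) : Prop :=
  exists (f : cantor_space -> C) (g : C -> cantor_space),
    [/\ continuous f, {within A, continuous g}, range f = A & cancel f g].

(** All real representatives of the angles in Theta, which are taken mod 1. *)
Definition Theta (n b : nat) (phi : R) : set R :=
  [set theta | exists (l m : nat) (k : int), [/\ (l < b)%N, (m < n)%N &
     theta = l%:R * phi + m%:R / n%:R + (2 * n%:R)^-1 + k%:~R]].

End Defs.

Arguments root_ifs {R} n c j z.
Arguments Lambda {R} n c.
Arguments E {R} n c theta.
Arguments W {R} n c theta.
Arguments Theta {R} n b phi.

(* Main.v *)
Require Import Defs.
From HB Require Import structures.
From mathcomp Require Import all_boot all_order all_algebra perm.
From mathcomp Require Import complex.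
From mathcomp Require Import all_classical all_reals all_analysis.
From mathcomp Require Import zify ring lra.

Set Implicit Arguments.
Unset Strict Implicit.
Unset Printing Implicit Defensive.

Import Order.TTheory GRing.Theory Num.Theory.
Import numFieldNormedType.Exports.

Local Open Scope classical_set_scope.
Local Open Scope card_scope.
Local Open Scope complex_scope.
Local Open Scope ring_scope.

(** A point of the limit set is a series whose k-th term is c^k xi^j, a complex
    number of modulus |c|^k and angle k phi + j/n, where the letter j is free. So
    [v theta] is maximized by maximizing every term separately
    ([extreme_wordsE]): the extreme words at the angle theta are the words all of
    whose letters bring k phi + j/n as close to theta as possible modulo 1. This
    determines the k-th letter unless k phi - theta lies half-way between
    consecutive multiples of 1/n, in which case exactly two letters are optimal, with the
    angles theta - 1/(2n) and theta + 1/(2n) ([unique_optimal], [pair_optimal]).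
    Everything depends on where such ties occur.

    If phi is irrational, two ties would make a nonzero multiple of phi rational,
    so there is at most one. Hence there are one or two extreme words, and two of
    them differ in a single term and have different points. Ties occur at the
    angles k phi + 1/(2n), which are dense by [multiples_dense], and never at
    rational translates of - phi. A convex limit set would contain the midpoint
    of an extreme pair of points, which would be a third extreme point.

    If phi = p/q, then b is the order of phi modulo 1/n. The ties at theta fill
    no residue class modulo b, or exactly one, and theta belongs to Theta in the
    second case ([ThetaP], [tie_mod], [tie_uniq_mod]). As c^b is |c|^b times an
    n-th root of unity, the blocks of b letters repeat up to a rotation of the
    letters and a scaling by rho = |c|^b, so that the extreme points at an angle
    of Theta are the limit set of two maps of ratio rho ([Theta_two_maps]). Such
    a set has a segment as its hull, equals it if rho >= 1/2, and is a Cantor set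
    that misses the midpoint otherwise. This also gives the bound on |c| for a
    convex limit set.

    For the convex hull, blocks turn the limit set into that of finitely many maps
    z |-> rho z + u with rho real ([Lambda_block]). A point of such a limit set is
    a weighted mean of the fixed points u / (1 - rho) ([address_in_convex]), so
    the hull is spanned by finitely many points. Its face at an angle theta is the
    hull of the extreme points at theta ([extreme_hull]): a segment for theta in
    Theta, one point for any other theta. The nb pairs (l, m) give different
    angles modulo 1, again because b is the order of phi modulo 1/n.

    Limit sets are handled through [address]: the limit set of maps
    z |-> c z + u_j is the set of the points with an address
    ([is_limit_set_address]), and any bounded set that its images cover consists
    of such points ([covered_address]). *)

(** * Limits of complex functions *)

Section ComplexTopology.
Context {R : realType}.
Implicit Types (z w : R[i]).

Lemma complex_normE z : `|z| = (normc z)%:C.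
Proof. by []. Qed.

Lemma normc_ge0 z : 0 <= normc z.
Proof. by case: z => a b; exact: sqrtr_ge0. Qed.

Lemma normcB z w : normc (z - w) = normc (w - z).
Proof. by rewrite -normcN opprB. Qed.

Lemma normcX z n : normc (z ^+ n) = normc z ^+ n.
Proof. by elim: n => [|n IH]; rewrite ?expr0 ?normc1 // !exprS normcM IH. Qed.

Lemma normc_realC (x : R) : normc x%:C = `|x|.
Proof. by rewrite /normc /= expr0n /= addr0 sqrtr_sqr. Qed.

Lemma normc_Re z : `|complex.Re z| <= normc z.
Proof. by rewrite -(lecR); exact: normc_ge_Re. Qed.

Lemma normc_Im z : `|complex.Im z| <= normc z.
Proof.
case: z => a b /=.
by rewrite -(sqrtr_sqr b) ler_wsqrtr // lerDr sqr_ge0.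
Qed.

Lemma normc_le_ReIm z : normc z <= `|complex.Re z| + `|complex.Im z|.
Proof.
case: z => a b /=.
rewrite -[leRHS]ger0_norm ?addr_ge0 // -sqrtr_sqr ler_wsqrtr //.
rewrite sqrrD !real_normK ?num_real //.
by rewrite addrAC lerDl mulrn_wge0 // mulr_ge0.
Qed.

Lemma normc_sum (I : Type) (r : seq I) (P : pred I) (f : I -> R[i]) :
  normc (\sum_(i <- r | P i) f i) <= \sum_(i <- r | P i) normc (f i).
Proof.
apply: (big_ind2 (fun x y => normc x <= y)) => //; first by rewrite normc0.
by move=> x1 x2 y1 y2 h1 h2; rewrite (le_trans (le_normcD _ _)) // lerD.
Qed.

Lemma cvgcP (T : Type) (F : set_system T) (FF : Filter F) (f : T -> R[i]) l :
  f @ F --> l <-> forall e : R, 0 < e -> \forall t \near F, normc (l - f t) < e.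
Proof.
split=> [/cvgrPdist_lt h e e0|h].
  have : (0 : R[i]) < e%:C by rewrite ltcR.
  by move=> /h; apply: filterS => t; rewrite complex_normE ltcR.
apply/cvgrPdist_lt => e; rewrite ltcE => /andP[/eqP ime re].
have -> : e = (complex.Re e)%:C by case: e ime re => a b /= -> _.
by apply: filterS (h _ re) => t; rewrite complex_normE ltcR.
Qed.

Lemma cvgc_ReIm (T : Type) (F : set_system T) (FF : Filter F) (f : T -> R[i]) l :
  (fun t => complex.Re (f t)) @ F --> complex.Re l ->
  (fun t => complex.Im (f t)) @ F --> complex.Im l -> f @ F --> l.
Proof.
move=> /cvgrPdist_lt hr /cvgrPdist_lt hi; apply/cvgcP => e e0.
have e20 : 0 < e / 2 by rewrite divr_gt0.
apply: filterS2 (hr _ e20) (hi _ e20) => t h1 h2.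
rewrite (le_lt_trans (normc_le_ReIm _)) // [ltRHS]splitr.
by rewrite !raddfB ltrD.
Qed.

(** Lipschitz functions preserve limits; this serves the norm, the real part
    and every [v theta]. *)
Lemma cvg_lip (T : Type) (F : set_system T) (FF : Filter F) (f : T -> R[i]) l
    (g : R[i] -> R) :
  (forall z w, `|g z - g w| <= normc (z - w)) ->
  f @ F --> l -> (g \o f) @ F --> g l.
Proof.
move=> hg /cvgcP h; apply/cvgrPdist_lt => e /h; apply: filterS => t.
exact: le_lt_trans (hg _ _).
Qed.

Lemma ler_dist_normc z w : `|normc z - normc w| <= normc (z - w).
Proof.
rewrite ler_norml; apply/andP; split.
  have := le_normcD (w - z) z; rewrite subrK normcB => h.
  by rewrite lerNl opprB lerBlDr.
by have := le_normcD (z - w) w; rewrite subrK lerBlDr.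
Qed.

Lemma normc_continuous : continuous (@normc R).
Proof.
move=> z; have h := @cvg_lip _ (nbhs z) (nbhs_filter z) id z _ ler_dist_normc.
by apply: h.
Qed.

Lemma compactc_bounded (A : set R[i]) :
  compact A -> exists2 M, 0 <= M & forall z, A z -> normc z <= M.
Proof.
move=> cA.
have := continuous_compact (continuous_subspaceT normc_continuous) cA.
move=> /compact_bounded [M [_ hM]]; exists (`|M| + 1).
  by rewrite addr_ge0.
move=> z Az; have lt : M < `|M| + 1 by rewrite (le_lt_trans (ler_norm M)) // ltrDl.
have /= := hM _ lt (normc z); rewrite ger0_norm ?normc_ge0 //; apply.
by exists z.
Qed.

Lemma cvgcnP (u : nat -> R[i]) l : u @ \oo --> l <->
  forall e : R, 0 < e -> exists N, forall m, (N <= m)%N -> normc (l - u m) < e.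
Proof.
rewrite cvgcP; split=> h e /h; first by case=> N _ hN; exists N.
by case=> N hN; exists N.
Qed.

Lemma cvgc_affine (T : Type) (F : set_system T) (FF : Filter F)
    (f : T -> R[i]) (l a b : R[i]) :
  f @ F --> l -> (fun t => a + b * f t) @ F --> a + b * l.
Proof.
move=> /cvgcP h; apply/cvgcP => e e0.
have b1 : 0 < normc b + 1 by rewrite ltr_wpDl ?normc_ge0.
apply: filterS (h (e / (normc b + 1)) _) => [t|]; last by rewrite divr_gt0.
rewrite ltr_pdivlMr // opprD addrACA subrr add0r -mulrBr normcM.
by apply: le_lt_trans; rewrite mulrC ler_wpM2l ?normc_ge0 // lerDl.
Qed.

Lemma cvgc_lim (u : nat -> R[i]) l : u @ \oo --> l -> limn u = l.
Proof. by apply: cvg_lim; exact: norm_hausdorff. Qed.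

End ComplexTopology.

(** * Points with a given address *)

Section Address.
Context {R : realType} {J : Type}.
Variables (c : R[i]) (u : J -> R[i]).

(** The point that the word [g] codes for the maps [z |-> c * z + u j], for an
    alphabet [J] of any type: blocks of letters will serve as letters too. *)
Definition address (g : nat -> J) : R[i] :=
  limn (fun m => \sum_(k < m) c ^+ k * u (g k)).

Hypotheses (M : R) (c1 : normc c < 1) (uM : forall j, normc (u j) <= M).

Lemma cvg_address (g : nat -> J) :
  (fun m => \sum_(k < m) c ^+ k * u (g k)) @ \oo --> address g.
Proof.
have part_cvg (p : R[i] -> R) : {morph p : x y / x + y} -> p 0 = 0 ->
    (forall z, `|p z| <= normc z) ->
    cvgn (fun m => p (\sum_(k < m) c ^+ k * u (g k))).
  move=> pD p0 pn.
  have -> : (fun m => p (\sum_(k < m) c ^+ k * u (g k))) =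
      series (fun k => p (c ^+ k * u (g k))).
    apply/funext => m; rewrite /series /= big_mkord.
    exact: (big_morph p pD p0).
  apply: normed_cvg; apply: (@series_le_cvg _ _ (geometric `|M| (normc c))).
  - by move=> k; exact: normr_ge0.
  - by move=> k; rewrite /geometric /= mulr_ge0 // exprn_ge0 // normc_ge0.
  - move=> k /=; rewrite (le_trans (pn _)) // normcM normcX mulrC.
    rewrite ler_wpM2r ?exprn_ge0 ?normc_ge0 //.
    by rewrite (le_trans (uM _)) // ler_norm.
  - by apply: is_cvg_geometric_series; rewrite ger0_norm ?normc_ge0.
have hr := part_cvg (@complex.Re R) (raddfD _) erefl (@normc_Re R).
have hi := part_cvg (@complex.Im R) (raddfD _) erefl (@normc_Im R).
apply: (cvgP (lim (complex.Re (\sum_(k < m) c ^+ k * u (g k)) @[m --> \oo]) +i*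
              lim (complex.Im (\sum_(k < m) c ^+ k * u (g k)) @[m --> \oo]))).
by apply: cvgc_ReIm.
Qed.

Lemma address_cons g : address g = u (g 0%N) + c * address (fun k => g k.+1).
Proof.
have h := (cvgcnP _ _).1 (cvgc_affine (a := u (g 0%N)) (b := c) _
  (@cvg_address (fun k => g k.+1))).
apply: cvgc_lim; apply/cvgcnP => e /h[N hN]; exists N.+1 => -[//|m] /hN.
rewrite big_ord_recl expr0 mul1r mulr_sumr.
by under [in X in X -> _]eq_bigr do rewrite mulrA -exprS.
Qed.

Lemma address_split g m : address g =
  \sum_(k < m) c ^+ k * u (g k) + c ^+ m * address (fun k => g (m + k)%N).
Proof.
elim: m => [|m IH]; first by rewrite big_ord0 add0r expr0 mul1r.
rewrite {}IH big_ord_recr /= -addrA; congr (_ + _).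
rewrite address_cons addn0 mulrDr mulrA -exprSr; congr (_ + _ * address _).
by apply/funext => k; rewrite addnS.
Qed.

Definition update (g : nat -> J) k j : nat -> J := fun i => if i == k then j else g i.

Lemma address_update g k j :
  address (update g k j) - address g = c ^+ k * (u j - u (g k)).
Proof.
have tail : (fun i => update g k j (k.+1 + i)%N) = (fun i => g (k.+1 + i)%N).
  by apply/funext => i; rewrite /update gtn_eqF // ltn_addr.
rewrite (address_split _ k.+1) (address_split g k.+1) tail opprD addrACA subrr addr0.
rewrite !big_ord_recr /= {2}/update eqxx.
under eq_bigr => i _ do rewrite /update ltn_eqF //.
by rewrite opprD addrACA subrr add0r -mulrBr.
Qed.

(** The partial sums stay below the solution B of B = M + |c| B, and so does
    their limit. *)
Lemma norm_address g : normc (address g) <= M / (1 - normc c).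
Proof.
have c'0 : 0 < 1 - normc c by rewrite subr_gt0.
apply/ler_addgt0Pr => e e0.
have /cvgcP/(_ e e0)[N _ /(_ N (leqnn N)) /ltW h] := @cvg_address g.
set B := M / _.
have B0 : 0 <= B.
  by rewrite divr_ge0 ?(ltW c'0) // (le_trans (normc_ge0 (u (g 0%N)))).
have BE : M + normc c * B = B by rewrite /B; field; rewrite gt_eqF.
have part m (g' : nat -> J) : normc (\sum_(k < m) c ^+ k * u (g' k)) <= B.
  elim: m g' => [|m IH] g'; first by rewrite big_ord0 normc0.
  rewrite big_ord_recl expr0 mul1r -BE (le_trans (le_normcD _ _)) // lerD //.
  have -> : \sum_(i < m) c ^+ lift ord0 i * u (g' (lift ord0 i)) =
      c * \sum_(i < m) c ^+ i * u (g' i.+1).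
    by rewrite mulr_sumr; apply: eq_bigr => i _; rewrite mulrA -exprS.
  by rewrite normcM ler_wpM2l ?normc_ge0 // (IH (fun k => g' k.+1)).
rewrite /= in h; set s := \sum_(k < N) _ in h.
by rewrite -(subrK s (address g)) (le_trans (le_normcD _ _)) // addrC lerD ?part.
Qed.

(** After a common prefix of length m only tails scaled by |c|^m remain. This
    is continuity for the product topology on words. *)
Lemma address_near e : 0 < e -> exists m, forall g g',
  (forall k, (k < m)%N -> g k = g' k) -> normc (address g - address g') < e.
Proof.
move=> e0; set B := M / (1 - normc c).
have /cvgrPdist_lt h : (fun m => normc c ^+ m * (B + B)) @ \oo --> 0.
  rewrite -[X in _ --> X](mul0r (B + B)); apply: cvgM; last exact: cvg_cst.
  by apply: cvg_expr; rewrite ger0_norm ?normc_ge0.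
have [m _ /(_ m (leqnn m))] := h _ e0; rewrite sub0r normrN => hm.
exists m => g g' gg'; apply: le_lt_trans hm; rewrite ler_normr; apply/orP; left.
rewrite (address_split g m) (address_split g' m).
under eq_bigr => k _ do rewrite gg' //.
rewrite opprD addrACA subrr add0r -mulrBr normcM normcX.
rewrite ler_wpM2l ?exprn_ge0 ?normc_ge0 // (le_trans (le_normcD _ _)) //.
by rewrite normcN lerD ?norm_address.
Qed.

(** Choosing a map whose image contains the point, again and again, spells an
    address; boundedness of [L] makes the remainders vanish. *)
Lemma covered_address (L : set R[i]) N :
  (forall z, L z -> normc z <= N) ->
  (forall z, L z -> exists j z', L z' /\ z = c * z' + u j) ->
  L `<=` range address.
Proof.
move=> LN cov z0 Lz0.
have [nxt hnxt] : {f : {z | L z} -> J * {z | L z} &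
    forall z, sval z = c * sval (f z).2 + u (f z).1}.
  apply: (@choice _ _ (fun z p => sval z = c * sval p.2 + u p.1)) => -[z Lz] /=.
  by have [j [z' [Lz' zE]]] := cov z Lz; exists (j, exist _ z' Lz').
pose st := fun k => iter k (fun p => (nxt p).2) (exist _ z0 Lz0).
pose g := fun k => (nxt (st k)).1.
have gE m : z0 = \sum_(k < m) c ^+ k * u (g k) + c ^+ m * sval (st m).
  elim: m => [|m IH]; first by rewrite big_ord0 add0r expr0 mul1r.
  rewrite big_ord_recr /= {}[LHS]IH -addrA; congr (_ + _).
  by rewrite {1}hnxt mulrDr mulrA -exprSr addrC.
exists g => //; apply: cvgc_lim; apply/cvgcP => e e0.
have /cvgrPdist_lt h : (fun m => normc c ^+ m * N) @ \oo --> 0.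
  rewrite -[X in _ --> X](mul0r N); apply: cvgM; last exact: cvg_cst.
  by apply: cvg_expr; rewrite ger0_norm ?normc_ge0.
apply: filterS (h _ e0) => m; rewrite sub0r normrN; apply: le_lt_trans.
rewrite ler_normr; apply/orP; left.
rewrite {1}(gE m) addrAC subrr add0r normcM normcX.
by rewrite ler_wpM2l ?exprn_ge0 ?normc_ge0 // LN //; case: (st m).
Qed.

(** The images of any one point of [L] under longer and longer compositions
    converge to the point with the given address. *)
Lemma address_closed (L : set R[i]) :
  L !=set0 -> closed L -> (forall j z, L z -> L (c * z + u j)) ->
  range address `<=` L.
Proof.
move=> [z0 Lz0] cL Linv _ [g _ <-].
have Lm m : forall g : nat -> J, L (\sum_(k < m) c ^+ k * u (g k) + c ^+ m * z0).
  elim: m => [|m IH] g'; first by rewrite big_ord0 add0r expr0 mul1r.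
  rewrite big_ord_recl expr0 mul1r.
  have := Linv (g' 0%N) _ (IH (fun k => g' k.+1)).
  rewrite mulrDr mulrA -exprS addrC addrA mulr_sumr.
  by under eq_bigr do rewrite mulrA -exprS.
apply: (@closed_cvg _ _ \oo _ (fun m => \sum_(k < m) c ^+ k * u (g k) + c ^+ m * z0) L cL).
  exact: nearW.
rewrite -[X in _ --> X]addr0; apply: cvgD; first exact: cvg_address.
apply/cvgcP => e e0.
have /cvgrPdist_lt h : (fun m => normc c ^+ m * normc z0) @ \oo --> 0.
  rewrite -[X in _ --> X](mul0r (normc z0)); apply: cvgM; last exact: cvg_cst.
  by apply: cvg_expr; rewrite ger0_norm ?normc_ge0.
apply: filterS (h _ e0) => m; rewrite sub0r normrN.
by rewrite sub0r normcN normcM normcX ger0_norm // mulr_ge0 ?exprn_ge0 ?normc_ge0.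
Qed.

End Address.

(** * Limit sets of affine systems with a common ratio *)

Section AffineIFS.
Context {R : realType}.
Variable c : R[i].
Hypothesis c1 : normc c < 1.

Lemma finite_bound (J : finType) (u : J -> R[i]) :
  forall j, normc (u j) <= \sum_j normc (u j).
Proof. by move=> j; rewrite (bigD1 j) //= lerDl sumr_ge0 // => *; exact: normc_ge0. Qed.

Lemma address_continuous (K : discreteTopologicalType) (u : K -> R[i]) M :
  (forall j, normc (u j) <= M) ->
  continuous (address c u : prod_topology (fun _ : nat => K) -> R[i]).
Proof.
move=> uM g.
pose T := prod_topology (fun _ : nat => K).
have h := @cvgcP R T (nbhs (g : T)) (nbhs_filter _) (address c u) (address c u g).
apply/h => e e0 {h}.
have [m hm] := address_near c1 uM e0.
have : \forall g' \near (g : prod_topology (fun _ : nat => K)),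
    forall k, (k < m)%N -> g k = g' k.
  elim: m {hm} => [|m IH]; first by apply: (@filterE T _ (nbhs_filter _)).
  have pm : \forall g' \near (g : prod_topology (fun _ : nat => K)), g m = g' m.
    have := @proj_continuous _ (fun _ : nat => K) m g _ (discrete_set1 (g m)).
    by apply: (@filterS T _ (nbhs_filter _)) => g' /= <-.
  apply: (@filterS2 T _ (nbhs_filter _) _ _ _ _ IH pm) => g' h1 h2 k; rewrite ltnS leq_eqVlt => /orP[/eqP->//|].
  exact: h1.
by apply: (@filterS T _ (nbhs_filter _)) => g'; exact: hm.
Qed.

(** By Tychonoff, words over a finite alphabet form a compact space. *)
Lemma address_compact (J : finType) (u : J -> R[i]) : compact (range (address c u)).
Proof.
have cT : compact [set: prod_topology (fun _ : nat => discrete_topology J)].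
  have fJ : compact [set: discrete_topology J].
    by apply: finite_compact; exact: (@finite_finset J).
  have := @tychonoff _ (fun _ : nat => discrete_topology J) _ (fun=> fJ).
  by congr (compact _); apply/seteqP; split.
have h := @address_continuous (discrete_topology J) u _ (finite_bound u).
exact: (continuous_compact (continuous_subspaceT h) cT).
Qed.

(** A compact invariant set is bounded, hence every point of it has an address,
    and closed, hence it contains every point with an address. *)
Lemma is_limit_set_address k (u : 'I_k -> R[i]) (L : set R[i]) : (0 < k)%N ->
  is_limit_set (fun j z => c * z + u j) L <-> L = range (address c u).
Proof.
move=> k0; have uM := finite_bound u; split.
  move=> [L0 Lc LE]; apply/seteqP; split.
    have [N _ LN] := compactc_bounded Lc.
    apply: (covered_address c1 LN) => z; rewrite {1}LE => -[j _ [z' Lz' <-]].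
    by exists j, z'.
  apply: (address_closed c1 uM L0).
    by apply: compact_closed => //; exact: norm_hausdorff.
  by move=> j z Lz; rewrite LE; exists j => //; exists z.
move=> ->; split; first by exists (address c u (fun=> Ordinal k0)); eexists.
  exact: address_compact.
apply/seteqP; split.
  move=> _ [g _ <-]; exists (g 0%N) => //; exists (address c u (fun k => g k.+1)).
    by eexists.
  by rewrite [RHS](address_cons c1 uM) addrC.
move=> _ [j _ [_ [g _ <-] <-]]; exists (fun k => if k is k'.+1 then g k' else j) => //.
by rewrite (address_cons c1 uM) addrC.
Qed.

Lemma limit_set_address k (u : 'I_k -> R[i]) : (0 < k)%N ->
  limit_set (fun j z => c * z + u j) = range (address c u).
Proof.
move=> k0; apply/(is_limit_set_address _ _ k0).
by apply: xgetPex; exists (range (address c u)); exact/is_limit_set_address.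
Qed.

End AffineIFS.

Section RootIFS.
Context {R : realType}.
Variables (n : nat) (c : R[i]).
Hypotheses (n0 : (0 < n)%N) (c1 : normc c < 1).

Definition unit_root (j : 'I_n) : R[i] := cexp n%:R^-1 ^+ j.

Lemma coding_address : coding (@root_ifs R n c) = address c unit_root.
Proof.
apply/funext => w; rewrite /coding /address; congr (limn _).
by apply/funext => m; rewrite word_map_root_ifs mulr0 addr0.
Qed.

Lemma LambdaE : Lambda n c = range (address c unit_root).
Proof. exact: limit_set_address. Qed.

End RootIFS.

Arguments unit_root {R n} j.

(** * Angles in turns *)

Section Cexp.
Context {R : realType}.
Implicit Types (s t : R).

Lemma cexpD s t : cexp (s + t) = cexp s * cexp t.
Proof.
by rewrite /cexp mulrDr cosD sinD; simpc; congr (_ +i* _); ring.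
Qed.

Lemma cexp0 : cexp 0 = 1 :> R[i].
Proof. by rewrite /cexp mulr0 cos0 sin0. Qed.

Lemma cexp1 : cexp 1 = 1 :> R[i].
Proof. by rewrite /cexp mulr1 mulr_natl cos2pi sin2pi. Qed.

Lemma cexp_half : cexp 2^-1 = - 1 :> R[i].
Proof.
rewrite /cexp (mulrC 2) -mulrA mulfV // mulr1 cospi sinpi.
by apply/eqP; rewrite eq_complex /= oppr0 !eqxx.
Qed.

Lemma cexpN_mul t : cexp (- t) * cexp t = 1.
Proof. by rewrite -cexpD addNr cexp0. Qed.

Lemma cexpMn t (k : nat) : cexp (k%:R * t) = cexp t ^+ k.
Proof.
elim: k => [|k IH]; first by rewrite mul0r cexp0.
by rewrite -natr1 mulrDl mul1r cexpD IH exprSr.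
Qed.

Lemma cexp_int (k : int) : cexp k%:~R = 1 :> R[i].
Proof.
have nat (m : nat) : cexp m%:R = 1 :> R[i].
  by rewrite -[m%:R]mulr1 cexpMn cexp1 expr1n.
case: k => k; first exact: nat.
by rewrite NegzE mulrNz -[LHS]mulr1 -[X in _ * X](nat k.+1) cexpN_mul.
Qed.

Lemma cexpDint t (k : int) : cexp (t + k%:~R) = cexp t.
Proof. by rewrite cexpD cexp_int mulr1. Qed.

Lemma normc_cexp t : normc (cexp t) = 1.
Proof. by rewrite /= cos2Dsin2 sqrtr1. Qed.

Lemma cexp_neq0 t : cexp t != 0.
Proof.
by apply/eqP => h; have := normc_cexp t; rewrite h normc0 => /eqP; rewrite eq_sym oner_eq0.
Qed.

Lemma cosDint t (k : int) : cos (2 * pi * (t + k%:~R)) = cos (2 * pi * t).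
Proof. by have /(congr1 (@complex.Re R)) := cexpDint t k. Qed.

Lemma cos_turn_lt s t : `|s| < `|t| -> `|t| <= 2^-1 ->
  cos (2 * pi * t) < cos (2 * pi * s).
Proof.
have p0 := @pi_gt0 R; move=> st t2.
rewrite -(cos_norm (_ * t)) -(cos_norm (_ * s)) !normrM.
rewrite (ger0_norm (ler0n _ 2)) (gtr0_norm p0).
rewrite ltr_cos ?in_itv /=.
- by rewrite ltr_pM2l // mulr_gt0.
- by apply/andP; split; [rewrite !mulr_ge0 // ltW|nra].
- apply/andP; split; first by rewrite !mulr_ge0 // ltW.
  by have := normr_ge0 s; nra.
Qed.

Lemma nearest_int t : exists k : int, `|t - k%:~R| <= 2^-1.
Proof.
exists (Num.floor (t + 2^-1)).
have h1 := floor_le_tmp (t + 2^-1); have h2 := floorD1_gt (t + 2^-1).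
rewrite ler_norml; apply/andP; split; lra.
Qed.

End Cexp.

(** * Translates of an angle by multiples of 1/n *)

Section Lattice.
Context {R : realType} {n : nat}.
Hypothesis n0 : (0 < n)%N.
Implicit Types (x y : R).

Let nR0 : 0 < n%:R :> R. Proof. by rewrite ltr0n. Qed.

(** The cosine decreases with the distance of the angle to the integers. If [x]
    is within 1/(2n) of 0, no translate of [x] by a multiple of 1/n is closer to
    the integers than [x], and only the mirror image [- x] can be as close. *)
Lemma cos_lattice x (d : int) : `|x| <= (2 * n%:R)^-1 ->
  [\/ exists k : int, d = k * n%:Z,
      cos (2 * pi * (x + d%:~R / n%:R)) < cos (2 * pi * x)
    | `|x| = (2 * n%:R)^-1 /\ exists k : int, x + d%:~R / n%:R = - x + k%:~R].
Proof.
move=> xn.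
have [k hk] := nearest_int (x + d%:~R / n%:R).
set s := x + _ - _ in hk.
have [->|dk] := eqVneq d (k * n%:Z); first by constructor 1; exists k.
have e1 : (1 : R) <= `|(d - k * n%:Z)%:~R|.
  by rewrite -intr_norm ler1z -gtz0_ge1 normr_gt0 subr_eq0.
have sE : s = x + (d - k * n%:Z)%:~R / n%:R.
  by rewrite /s rmorphB rmorphM /=; field; rewrite gt_eqF.
have xs : `|x| <= `|s|.
  have : `|(d - k * n%:Z)%:~R / n%:R| <= `|s| + `|x| :> R.
    rewrite (_ : _ / _ = s - x); last by rewrite sE; ring.
    exact: ler_normB.
  rewrite normrM normfV (gtr0_norm nR0).
  have : n%:R^-1 <= `|(d - k * n%:Z)%:~R| / n%:R :> R.
    by rewrite ler_peMl // invr_ge0 ltW.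
  move: xn; rewrite invfM; lra.
have cE : cos (2 * pi * (x + d%:~R / n%:R)) = cos (2 * pi * s).
  by rewrite -(cosDint s k) /s subrK.
move: xs; rewrite le_eqVlt => /orP[/eqP xs|xs]; last first.
  by constructor 2; rewrite cE cos_turn_lt.
constructor 3.
have sx : s = - x.
  case: (ltrgt0P x) xs sE dk e1 => [x0|x0|->] xs sE dk e1.
  - move: xs; case: (ger0P s) => s0 xs; last by rewrite xs opprK.
    suff : (d - k * n%:Z)%:~R = 0 :> R by move=> h; move: e1; rewrite h normr0 ler10.
    have : (d - k * n%:Z)%:~R / n%:R = 0 :> R by lra.
    by move/eqP; rewrite mulf_eq0 invr_eq0 (gt_eqF nR0) orbF => /eqP.
  - move: xs; case: (ger0P s) => s0 xs; first by rewrite xs.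
    suff : (d - k * n%:Z)%:~R = 0 :> R by move=> h; move: e1; rewrite h normr0 ler10.
    have : (d - k * n%:Z)%:~R / n%:R = 0 :> R by lra.
    by move/eqP; rewrite mulf_eq0 invr_eq0 (gt_eqF nR0) orbF => /eqP.
  - by move/esym/eqP: xs; rewrite normr_eq0 oppr0 => /eqP.
split; last by exists k; rewrite -sx /s; ring.
apply/eqP; rewrite eq_le xn /=.
have : `|(d - k * n%:Z)%:~R / n%:R| = 2 * `|x| :> R.
  rewrite (_ : _ / _ = - (2 * x)); first by rewrite normrN normrM ger0_norm.
  by move: sE; rewrite sx; lra.
rewrite normrM normfV (gtr0_norm nR0).
have : n%:R^-1 <= `|(d - k * n%:Z)%:~R| / n%:R :> R.
  by rewrite ler_peMl // invr_ge0 ltW.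
rewrite invfM; lra.
Qed.

Lemma residue (m : int) : exists (j : 'I_n) (k : int), j%:Z = m + k * n%:Z.
Proof.
have nz : n%:Z != 0 by rewrite -lt0n.
have lt : (`|(m %% n)%Z| < n)%N.
  by rewrite -ltz_nat gez0_abs ?modz_ge0 // ltz_pmod.
exists (Ordinal lt), (- (m %/ n)%Z) => /=.
by rewrite gez0_abs ?modz_ge0 // {2}(divz_eq m n) mulNr addrAC subrr add0r.
Qed.

Lemma residue_inj (i j : 'I_n) (k : int) : i%:Z = j%:Z + k * n%:Z -> i = j.
Proof.
move=> h; apply/val_inj => /=; rewrite -(modn_small (ltn_ord i)) -(modn_small (ltn_ord j)).
apply/eqP; rewrite -eqz_nat -!modz_nat h.
by rewrite -modzDmr modzMl addr0.
Qed.

(** Half-way between consecutive multiples of 1/n: these are the angles for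
    which two of the translates [y + j / n] are equally close to the integers. *)
Definition tie y := exists m : int, y = (2 * n%:R)^-1 + m%:~R / n%:R.

Lemma best_unique y : ~ tie y -> exists j0 : 'I_n, forall j, j != j0 ->
  cos (2 * pi * (y + j%:R / n%:R)) < cos (2 * pi * (y + j0%:R / n%:R)).
Proof.
move=> ny; have [f hf] := nearest_int (y * n%:R).
set x := y - f%:~R / n%:R.
have xE : x = (y * n%:R - f%:~R) / n%:R by rewrite /x; field; rewrite gt_eqF.
have xn : `|x| <= (2 * n%:R)^-1.
  by rewrite xE normrM normfV (gtr0_norm nR0) invfM ler_pM2r ?invr_gt0.
have [j0 [k0 hj0]] := residue (- f).
exists j0 => j jj0.
have -> : cos (2 * pi * (y + j0%:R / n%:R)) = cos (2 * pi * x).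
  rewrite -(cosDint x k0); congr (cos (_ * _)).
  have := congr1 (fun z : int => z%:~R : R) hj0.
  rewrite rmorphD rmorphN rmorphM /= !pmulrn => ->.
  by rewrite /x; field; rewrite gt_eqF.
have -> : y + j%:R / n%:R = x + (j%:Z + f)%:~R / n%:R.
  by rewrite /x rmorphD /= -pmulrn; field; rewrite gt_eqF.
have [[k hk]|//|[xe _]] := cos_lattice (j%:Z + f) xn.
  case/negP: jj0; apply/eqP; apply: (@residue_inj _ _ (k - k0)).
  by rewrite hj0 mulrBl -hk; ring.
case: ny; have [x0|x0] := ger0P x; [rewrite (ger0_norm x0) in xe|rewrite (ltr0_norm x0) in xe].
  by exists f; rewrite -xe /x; ring.
exists (f - 1); rewrite rmorphB /= -xe /x mulrBl.
have : n%:R^-1 = 2 * - x :> R by rewrite xe; field; rewrite gt_eqF.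
by rewrite /x; lra.
Qed.

Lemma best_pair y : (1 < n)%N -> tie y -> exists j0 j1 : 'I_n, [/\ j0 != j1,
  cexp (y + j0%:R / n%:R) = cexp (- (2 * n%:R)^-1),
  cexp (y + j1%:R / n%:R) = cexp (2 * n%:R)^-1
  & forall j, j != j0 -> j != j1 ->
      cos (2 * pi * (y + j%:R / n%:R)) < cos (2 * pi * (2 * n%:R)^-1)].
Proof.
move=> n1 [m yE].
(* these letters move [y] to 1/(2n) and to - 1/(2n), modulo 1 *)
have [j1 [k1 hj1]] := residue (- m); have [j0 [k0 hj0]] := residue (- m - 1).
have n2E : n%:R^-1 = 2 * (2 * n%:R)^-1 :> R by field; rewrite gt_eqF.
have e1 : y + j1%:R / n%:R = (2 * n%:R)^-1 + k1%:~R.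
  rewrite yE; have := congr1 (fun z : int => z%:~R : R) hj1.
  rewrite rmorphD rmorphN rmorphM /= !pmulrn => ->.
  by field; rewrite gt_eqF.
have e0 : y + j0%:R / n%:R = - (2 * n%:R)^-1 + k0%:~R.
  rewrite yE; have := congr1 (fun z : int => z%:~R : R) hj0.
  rewrite rmorphD rmorphB rmorphN rmorphM /= !pmulrn => ->.
  by field; rewrite gt_eqF.
exists j0, j1; split.
- apply/eqP => jj; move: hj0; rewrite jj hj1 => h.
  have : (1 : int) = (k0 - k1) * n%:Z by rewrite mulrBl; lia.
  move/(congr1 absz); rewrite abszM /= => /esym/eqP.
  by rewrite muln_eq1 => /andP[_ /eqP n11]; rewrite n11 in n1.
- by rewrite e0 cexpDint.
- by rewrite e1 cexpDint.
move=> j jj0 jj1.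
have -> : y + j%:R / n%:R = (2 * n%:R)^-1 + (j%:Z + m)%:~R / n%:R.
  by rewrite yE rmorphD /= -pmulrn; field; rewrite gt_eqF.
have xn : `|(2 * n%:R)^-1| <= (2 * n%:R)^-1 :> R.
  by rewrite ger0_norm // invr_ge0 mulr_ge0 // ltW.
have [[k hk]|//|[_ [k hk]]] := cos_lattice (j%:Z + m) xn.
  case/negP: jj1; apply/eqP; apply: (@residue_inj _ _ (k - k1)).
  by rewrite hj1 mulrBl -hk; ring.
case/negP: jj0; apply/eqP; apply: (@residue_inj _ _ (k - k0)).
have : (j%:Z + m)%:~R = (k * n%:Z - 1)%:~R :> R.
  have -> : (j%:Z + m)%:~R = ((j%:Z + m)%:~R / n%:R) * n%:R :> R.
    by field; rewrite gt_eqF.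
  have -> : (j%:Z + m)%:~R / n%:R = k%:~R - n%:R^-1 :> R by rewrite n2E; lra.
  by rewrite rmorphB rmorphM /= -pmulrn; field; rewrite gt_eqF.
move/intr_inj => h; rewrite hj0 mulrBl.
by lia.
Qed.

End Lattice.

(** * Extreme words and their letters *)

Section ExtremeWords.
Context {R : realType} {n : nat} {c : R[i]} {phi : R}.
Hypotheses (n0 : (0 < n)%N) (hc0 : 0 < normc c) (c1 : normc c < 1).
Hypothesis hphi : c = (normc c)%:C * cexp phi.
Implicit Types (theta : R) (w : nat -> 'I_n).

Lemma vD theta : {morph v theta : x y / x + y}.
Proof. by move=> x y; rewrite /v mulrDl raddfD. Qed.

Lemma v0 theta : v theta 0 = 0 :> R.
Proof. by rewrite /v mul0r. Qed.

Lemma vB theta (x y : R[i]) : v theta (x - y) = v theta x - v theta y.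
Proof. by rewrite /v mulrBl raddfB. Qed.

Lemma v_real theta (a : R) z : v theta (a%:C * z) = a * v theta z.
Proof.
rewrite /v -mulrA; case: (z * _) => x y.
by rewrite /= mul0r subr0.
Qed.

Lemma v_cexp theta t : v theta (cexp t) = cos (2 * pi * (t - theta)) :> R.
Proof. by rewrite /v -cexpD. Qed.

Lemma v_lip theta (z w : R[i]) : `|v theta z - v theta w| <= normc (z - w).
Proof. by rewrite -vB (le_trans (normc_Re _)) // normcM normc_cexp mulr1. Qed.

Lemma root_cexp (j : 'I_n) : unit_root j = cexp (j%:R / n%:R) :> R[i].
Proof. by rewrite /unit_root -cexpMn. Qed.

Lemma digitE k (j : 'I_n) :
  c ^+ k * unit_root j = (normc c ^+ k)%:C * cexp (k%:R * phi + j%:R / n%:R).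
Proof.
by rewrite {1}hphi exprMn -rmorphXn -mulrA root_cexp -cexpMn -cexpD.
Qed.

Definition gain theta k (j : 'I_n) : R :=
  cos (2 * pi * (k%:R * phi - theta + j%:R / n%:R)).

Lemma v_digit theta k j : v theta (c ^+ k * unit_root j) = normc c ^+ k * gain theta k j.
Proof. by rewrite digitE v_real v_cexp addrAC. Qed.

Definition optimal theta k j := forall j', gain theta k j' <= gain theta k j.

Lemma exists_optimal theta k : exists j, optimal theta k j.
Proof.
have [j _ jP] := @Order.TotalTheory.arg_maxP _ _ _ (Ordinal n0) xpredT (gain theta k) isT.
by exists j => j'; apply: jP.
Qed.

Let uM := finite_bound (@unit_root R n).

(** Replacing one letter of an extreme word cannot increase [v theta], so each of
    its letters is optimal; a word with optimal letters dominates every other one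
    term by term, hence in the limit. *)
Lemma extreme_wordsE theta : W n c theta = [set w | forall k, optimal theta k (w k)].
Proof.
rewrite /W /E LambdaE // coding_address; apply/seteqP; split=> w /=.
  move=> [_ wmax] k j; rewrite leNgt; apply/negP => lt.
  have := wmax _ (ex_intro2 _ _ (update w k j) I erefl).
  apply/negP; rewrite -ltNge -subr_gt0 -vB (address_update c1 uM) mulrBr vB.
  by rewrite !v_digit -mulrBr mulr_gt0 ?exprn_gt0 // subr_gt0.
move=> wopt; split; first by exists w.
move=> _ [w' _ <-].
have cv (x : nat -> 'I_n) := @cvg_lip R nat \oo eventually_filter _ _ _ (v_lip theta)
  (cvg_address c1 uM (g := x)).
apply: (ler_cvg_to (cv w') (cv w)); apply: nearW => m /=.
rewrite !(big_morph _ (vD theta) (v0 theta)); apply: ler_sum => k _.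
by rewrite !v_digit ler_wpM2l ?exprn_ge0 ?normc_ge0 //; exact: wopt.
Qed.

Lemma E_coding theta : E n c theta = address c unit_root @` W n c theta.
Proof.
rewrite /W /= coding_address /E LambdaE //; apply/seteqP; split.
  by move=> _ [[w _ <-] h]; exists w => //; split => //; exists w.
by move=> _ [w h <-].
Qed.

Lemma unique_optimal theta k : ~ tie (n := n) (k%:R * phi - theta) ->
  exists j0, forall j, optimal theta k j <-> j = j0.
Proof.
move=> /(best_unique n0)[j0 h]; exists j0 => j; split=> [opt|->].
  apply/eqP; apply/negP => /negP /h; rewrite ltNge => /negP; apply; exact: opt.
by move=> j'; have [->//|/h/ltW] := eqVneq j' j0.
Qed.

(** At a tie the two optimal terms are mirror images of each other in the
    direction [theta], for they have the angles theta - 1/(2n), theta + 1/(2n). *)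
Lemma pair_optimal theta k : (1 < n)%N -> tie (n := n) (k%:R * phi - theta) ->
  exists j0 j1 : 'I_n, [/\ j0 != j1, forall j, optimal theta k j <-> j = j0 \/ j = j1,
    c ^+ k * unit_root j0 = (normc c ^+ k)%:C * cexp (theta - (2 * n%:R)^-1) &
    c ^+ k * unit_root j1 = (normc c ^+ k)%:C * cexp (theta + (2 * n%:R)^-1)].
Proof.
move=> n1 /(best_pair n0 n1)[j0 [j1 [j01 e0 e1 h]]]; exists j0, j1.
have g0 : gain theta k j0 = cos (2 * pi * (2 * n%:R)^-1).
  by have := congr1 (@complex.Re R) e0; rewrite /= mulrN cosN.
have g1 : gain theta k j1 = cos (2 * pi * (2 * n%:R)^-1).
  by have := congr1 (@complex.Re R) e1.
have le j : gain theta k j <= cos (2 * pi * (2 * n%:R)^-1).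
  have [->|jj0] := eqVneq j j0; first by rewrite g0.
  have [->|jj1] := eqVneq j j1; first by rewrite g1.
  exact/ltW/h.
have dig (j : 'I_n) s : cexp (k%:R * phi - theta + j%:R / n%:R) = cexp s ->
    c ^+ k * unit_root j = (normc c ^+ k)%:C * cexp (theta + s).
  by move=> hs; rewrite digitE cexpD -hs -cexpD; congr (_ * cexp _); ring.
split => //; [|exact: dig|exact: dig].
move=> j; split=> [opt|[->|->] j']; rewrite ?g0 ?g1 //.
have [->|jj0] := eqVneq j j0; first by left.
have [->|jj1] := eqVneq j j1; first by right.
have := h j jj0 jj1; rewrite ltNge => /negP[].
by rewrite -g0; exact: opt.
Qed.

End ExtremeWords.

(** * Convexity, hulls and extreme points *)

Section Convex.
Context {R : realType}.
Implicit Types (A : set R[i]) (x y : R[i]) (t : R).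

Lemma convexP A : convex A <-> forall x y t, 0 <= t <= 1 -> A x -> A y ->
  A ((1 - t)%:C * x + t%:C * y).
Proof.
have cE t (x y : R[i]) : t *: (x : Rcomplex R) + (1 - t) *: (y : Rcomplex R) =
    t%:C * x + (1 - t)%:C * y.
  by case: x => a b; case: y => d e; simpc.
split=> [cA x y t /andP[t0 t1] Ax Ay|cA x y t /set_mem Ax /set_mem Ay].
  have t0' : 0 <= 1 - t by rewrite subr_ge0.
  have t1' : 1 - t <= 1 by rewrite gerBl.
  have := cA x y (Itv01 t0' t1') (mem_set Ax) (mem_set Ay).
  by rewrite -[X in A (_ + X%:C * _)](subKr 1 t) -cE => /set_mem.
apply/mem_set; have := cA x y (1 - t%:num) _ Ax Ay.
rewrite subKr -cE; apply.
by rewrite subr_ge0 gerBl; apply/andP.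
Qed.

Lemma v_conv theta x y t : v theta ((1 - t)%:C * x + t%:C * y) =
  (1 - t) * v theta x + t * v theta y.
Proof. by rewrite vD !v_real. Qed.

Lemma extreme_convex A theta : convex A -> convex (extreme_at A theta).
Proof.
move=> /convexP cA; apply/convexP => x y t t01 [Ax xmax] [Ay ymax].
split; first exact: cA.
move=> q Aq; rewrite v_conv; have := xmax _ Aq; have := ymax _ Aq.
case/andP: t01 => t0 t1; nra.
Qed.

End Convex.

Section Hull.
Context {R : realType}.
Implicit Types (A K : set R[i]) (x y z : R[i]) (t : R).

Lemma hull_sub A : A `<=` convex_hull A.
Proof. exact: sub_gen_smallest. Qed.

Lemma hull_min A K : A `<=` K -> convex K -> convex_hull A `<=` K.
Proof. by move=> AK cK; exact: smallest_sub. Qed.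

Lemma hull_convex A : convex (convex_hull A).
Proof.
apply/convexP => x y t t01 hx hy K [cK AK]; move/convexP: (cK); apply => //.
  exact: (hx K (conj cK AK)).
exact: (hy K (conj cK AK)).
Qed.

Lemma hull_id K : convex K -> convex_hull K = K.
Proof. exact: smallest_id. Qed.

Lemma segmentP x y z :
  segment x y z <-> exists2 t : R, 0 <= t <= 1 & z = (1 - t)%:C * x + t%:C * y.
Proof.
split=> [[t /=]|[t t01 ->]]; first by rewrite in_itv /= => t01 <-; exists t.
by exists t => //=; rewrite in_itv.
Qed.

Lemma segment_left x y : segment x y x.
Proof. by apply/segmentP; exists 0; rewrite ?lexx ?ler01 // subr0 mul1r mul0r addr0. Qed.

Lemma segment_right x y : segment x y y.
Proof. by apply/segmentP; exists 1; rewrite ?lexx ?ler01 // subrr mul1r mul0r add0r. Qed.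

Lemma segment_sub K x y : convex K -> K x -> K y -> segment x y `<=` K.
Proof. by move=> /convexP cK Kx Ky z /segmentP[t t01 ->]; exact: cK. Qed.

Lemma segment_convex x y : convex (segment x y).
Proof.
apply/convexP => _ _ t t01 /segmentP[s s01 ->] /segmentP[u u01 ->].
apply/segmentP; exists ((1 - t) * s + t * u).
  by case/andP: t01 => *; case/andP: s01 => *; case/andP: u01 => *; apply/andP; split; nra.
by rewrite !(rmorphB, rmorphD, rmorphM, rmorph1) /=; ring.
Qed.

Lemma hull_segment A x y : A x -> A y -> A `<=` segment x y ->
  convex_hull A = segment x y.
Proof.
move=> Ax Ay As; apply/seteqP; split; first exact: (hull_min As (@segment_convex x y)).
by apply: segment_sub; [exact: hull_convex|exact: hull_sub..].
Qed.

Lemma convex_comb (J : finType) K (u : J -> R[i]) (t : J -> R) :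
  convex K -> (forall j, K (u j)) -> (forall j, 0 <= t j) -> \sum_j t j = 1 ->
  K (\sum_j (t j)%:C * u j).
Proof.
move=> /convexP cK Ku t0.
(* partial sums, rescaled to total weight 1, stay in K *)
suff h (s : seq J) : 0 < \sum_(j <- s) t j ->
    K (((\sum_(j <- s) t j)^-1)%:C * \sum_(j <- s) (t j)%:C * u j).
  move=> t1; have := h (index_enum J).
  by rewrite t1 invr1 mul1r; apply; exact: ltr01.
elim: s => [|j s IH]; first by rewrite big_nil ltxx.
rewrite !big_cons; set S := \sum_(i <- s) t i in IH *.
have S0 : 0 <= S by rewrite sumr_ge0.
move=> jS0; move: S0; rewrite le_eqVlt => /orP[/eqP S0|S0].
  have tz : \sum_(i <- s) (t i)%:C * u i = 0.
    have : S = 0 by [].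
    rewrite /S; elim: (s) => [|i r IHr]; first by rewrite !big_nil.
    rewrite !big_cons => /eqP; rewrite paddr_eq0 ?sumr_ge0 //.
    by move=> /andP[/eqP -> /eqP /IHr ->]; rewrite mul0r addr0.
  rewrite tz -S0 !addr0 mulrA -rmorphM /= mulVf ?mul1r //.
  by rewrite -S0 addr0 in jS0; rewrite gt_eqF.
have := cK _ _ (S / (t j + S)) _ (Ku j) (IH S0).
have jS : t j + S != 0 by rewrite gt_eqF.
rewrite mulrDr !mulrA -!rmorphM /=.
have -> : 1 - S / (t j + S) = (t j + S)^-1 * t j by field.
have -> : S / (t j + S) / S = (t j + S)^-1 by field; rewrite jS gt_eqF.
apply; apply/andP; split; first by rewrite divr_ge0 ?ltW.
by rewrite ler_pdivrMr // mul1r lerDr.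
Qed.

(** The hull of [A] splits into its points strictly below the supporting line
    and the hull of the points of [A] on that line, since a proper combination
    of one point of each kind lies strictly below. *)
Lemma extreme_hull A theta : extreme_at A theta !=set0 ->
  extreme_at (convex_hull A) theta = convex_hull (extreme_at A theta).
Proof.
move=> [p [Ap pmax]]; set h := v theta p in pmax.
have EsubA : convex_hull (extreme_at A theta) `<=` convex_hull A.
  by apply: hull_min => [z [Az _]|]; [exact: hull_sub|exact: hull_convex].
have Elevel z : convex_hull (extreme_at A theta) z -> v theta z = h.
  move: z; apply: hull_min => [z [Az zmax]|].
    by apply/eqP; rewrite eq_le pmax // zmax.
  by apply/convexP => x y t t01; rewrite /= v_conv => -> ->; ring.
have split z : convex_hull A z ->
    convex_hull (extreme_at A theta) z \/ (convex_hull A z /\ v theta z < h).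
  move: z; apply: hull_min => [z Az|].
    have := pmax _ Az; rewrite le_eqVlt => /orP[/eqP zh|zh].
      by left; apply: hull_sub; split=> // q Aq; rewrite zh pmax.
    by right; split=> //; exact: hull_sub.
  have lvl z : convex_hull (extreme_at A theta) z \/
      (convex_hull A z /\ v theta z < h) -> convex_hull A z /\ v theta z <= h.
    by move=> [Ez|[Az /ltW //]]; split; [exact: EsubA|rewrite Elevel].
  apply/convexP => x y t /andP[t0 t1] hx hy.
  have Axy : convex_hull A ((1 - t)%:C * x + t%:C * y).
    move/convexP: (@hull_convex A); apply; [by rewrite t0|..].
      by case: (lvl _ hx).
    by case: (lvl _ hy).
  move: t0; rewrite le_eqVlt => /orP[/eqP t0|t0].
    by rewrite -t0 subr0 mul1r mul0r addr0.
  move: t1; rewrite le_eqVlt => /orP[/eqP t1|t1].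
    by rewrite t1 subrr mul1r mul0r add0r.
  have t1' : 0 < 1 - t by rewrite subr_gt0.
  case: (hx) => [Ex|[Ax xh]]; last first.
    right; split => //; rewrite v_conv; case: (lvl _ hy) => _ yh.
    by rewrite -subr_gt0 in xh; rewrite -subr_ge0 in yh; nra.
  case: (hy) => [Ey|[Ay yh]]; last first.
    right; split => //; rewrite v_conv; case: (lvl _ hx) => _ xh.
    by rewrite -subr_gt0 in yh; rewrite -subr_ge0 in xh; nra.
  left; move/convexP: (@hull_convex (extreme_at A theta)); apply => //.
  by rewrite !ltW.
apply/seteqP; split=> z.
  move=> [Az zmax]; case: (split z Az) => // -[_].
  by rewrite ltNge => /negP[]; apply: zmax; exact: hull_sub.
move=> Ez; split=> [|q Aq]; first exact: EsubA.
rewrite (Elevel _ Ez); case: (split q Aq) => [/Elevel -> //|[_ /ltW //]].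
Qed.

Lemma convex_triangle K p a b (s t : R) : convex K -> K p -> K (p + a) -> K (p + b) ->
  0 <= s -> 0 <= t -> s + t <= 1 -> K (p + s%:C * a + t%:C * b).
Proof.
move=> cK Kp Ka Kb s0 t0 st.
have := @convex_comb 'I_3 K (fun i => nth 0 [:: p; p + a; p + b] i)
  (fun i => nth 0 [:: 1 - s - t; s; t] i) cK.
rewrite !big_ord_recl !big_ord0 /= !addr0.
have -> : (1 - s - t)%:C * p + (s%:C * (p + a) + t%:C * (p + b)) =
    p + s%:C * a + t%:C * b.
  by rewrite !rmorphB rmorph1 /=; ring.
apply; last by ring.
  by case=> [[|[|[|]]]].
by case=> [[|[|[|]]]] //= _; lra.
Qed.

Lemma cramer (a b w : R[i]) (D := complex.Re a * complex.Im b - complex.Im a * complex.Re b) :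
  D != 0 ->
  w = ((complex.Re w * complex.Im b - complex.Im w * complex.Re b) / D)%:C * a +
      ((complex.Re a * complex.Im w - complex.Im a * complex.Re w) / D)%:C * b.
Proof.
rewrite {}/D; case: a => a1 a2; case: b => b1 b2; case: w => w1 w2 /= D0.
by simpc; congr (_ +i* _); field.
Qed.

(** Barycentric coordinates with respect to a nondegenerate triangle depend
    linearly on the point ([cramer]), so they stay nonnegative in a ball around
    the barycentre. *)
Lemma triangle_interior K p a b : convex K -> K p -> K (p + a) -> K (p + b) ->
  complex.Re a * complex.Im b - complex.Im a * complex.Re b != 0 ->
  K° !=set0.
Proof.
move=> cK Kp Ka Kb; set D := _ - _ => D0.
pose q := p + (3^-1 : R)%:C * (a + b).
have D0' : 0 < `|D| by rewrite normr_gt0.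
pose B := normc a + normc b + 1.
have B0 : 0 < B by rewrite ltr_wpDl // addr_ge0 ?normc_ge0.
(* By [small], moving by less than |D| / (12 B) changes the last two coordinates
   by at most 1/6 each; as they are 1/3 at [q], all three stay nonnegative. *)
exists q; apply/nbhs_ballP; exists (`|D| / (12 * B))%:C => /=.
  by rewrite ltcR divr_gt0 // mulr_gt0.
move=> z; rewrite /ball /= complex_normE ltcR normcB => zq.
have small (x y x' y' : R) (d : R[i]) : normc d <= B ->
    `|x| <= normc (z - q) -> `|y| <= normc (z - q) ->
    `|x'| <= normc d -> `|y'| <= normc d -> `|(x * x' - y * y') / D| <= 6^-1.
  move=> dB hx hy hx' hy'; rewrite normrM normfV ler_pdivrMr //.
  apply: le_trans (ler_normB _ _) _; rewrite !normrM.
  have N0 := normc_ge0 (z - q).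
  have h1 : `|x| * `|x'| <= normc (z - q) * B.
    by apply: ler_pM => //; exact: le_trans dB.
  have h2 : `|y| * `|y'| <= normc (z - q) * B.
    by apply: ler_pM => //; exact: le_trans dB.
  have h3 : normc (z - q) * B <= `|D| / (12 * B) * B by rewrite ler_pM2r // ltW.
  have h4 : `|D| / (12 * B) * B = `|D| / 12 by field; rewrite gt_eqF.
  by rewrite h4 in h3; lra.
have aB : normc a <= B by rewrite /B -addrA lerDl addr_ge0 ?normc_ge0.
have bB : normc b <= B by rewrite /B addrAC lerDr addr_ge0 ?normc_ge0.
have := cramer (z - q) D0; rewrite -/D.
set s := (_ / _); set t := ((_ - _) / D) => wE.
have hs : `|s| <= 6^-1 by apply: (small _ _ _ _ b); rewrite ?normc_Re ?normc_Im.
have ht : `|t| <= 6^-1.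
  rewrite /t (mulrC (complex.Re a)) (mulrC (complex.Im a)).
  by rewrite -normrN -mulNr opprB; apply: (small _ _ _ _ a); rewrite ?normc_Re ?normc_Im.
have -> : z = p + (3^-1 + s)%:C * a + (3^-1 + t)%:C * b.
  rewrite -(subrK q z) wE /q !rmorphD /=; ring.
move: hs ht; rewrite !ler_norml => /andP[s1 s2] /andP[t1 t2].
by apply: convex_triangle => //; lra.
Qed.

End Hull.

(** * Words with at most one tie *)

Lemma card_set2 (T : Type) (x y : T) : x <> y -> [set x; y] #= `I_2.
Proof.
move=> xy; pose f (i : nat) := if i is 0 then x else y.
have -> : [set x; y] = f @` `I_2.
  apply/seteqP; split=> [z [->|->]|z [[|[|//]] _ <-]];
    [exists 0%N|exists 1%N|left|right] => //.
apply: inj_card_eq => -[|[|i]] [|[|j]]; rewrite ?inE //= => _ _ h; by [case: xy|case: xy].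
Qed.

Section FewTies.
Context {R : realType} {n : nat} {c : R[i]} {phi : R}.
Hypotheses (n1 : (1 < n)%N) (hc0 : 0 < normc c) (c1 : normc c < 1).
Hypothesis hphi : c = (normc c)%:C * cexp phi.
Implicit Types (theta : R).

Let n0 : (0 < n)%N := ltnW n1.

Lemma no_tie_singleton theta : (forall k, ~ tie (n := n) (k%:R * phi - theta)) ->
  exists w, W n c theta = [set w] /\ E n c theta = [set address c unit_root w].
Proof.
move=> nt.
have [w hw] := choice (fun k => unique_optimal n0 (nt k)).
have We : W n c theta = [set w].
  rewrite (extreme_wordsE n0 hc0 c1 hphi); apply/seteqP; split=> w' /=.
    by move=> h; apply/funext => k; apply/hw.
  by move=> -> k; apply/hw.
by exists w; split => //; rewrite (E_coding n0 c1) We image_set1.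
Qed.

Lemma cexp_mirror_neq theta :
  cexp (theta - (2 * n%:R)^-1) <> cexp (theta + (2 * n%:R)^-1).
Proof.
have nR : 1 < n%:R :> R by rewrite ltr1n.
rewrite !cexpD => /(mulfI (cexp_neq0 _)) /(congr1 (@complex.Im R)) /eqP.
rewrite /= mulrN sinN -subr_eq0 -opprD oppr_eq0 -mulr2n mulrn_eq0 /= gt_eqF //.
apply: sin_gt0_pi; have p0 := @pi_gt0 R; apply/andP; split.
  by rewrite divr_gt0 ?mulr_gt0 // ltr0n.
rewrite ltr_pdivrMr; last by rewrite mulr_gt0 // ltr0n.
by nra.
Qed.

Lemma pair_optimal_neq theta k (j0 j1 : 'I_n) :
  c ^+ k * unit_root j0 = (normc c ^+ k)%:C * cexp (theta - (2 * n%:R)^-1) ->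
  c ^+ k * unit_root j1 = (normc c ^+ k)%:C * cexp (theta + (2 * n%:R)^-1) ->
  c ^+ k * unit_root j0 != c ^+ k * unit_root j1.
Proof.
move=> -> ->; apply/eqP => /mulfI h; apply: (@cexp_mirror_neq theta); apply: h.
by rewrite eq_complex /= eqxx andbT expf_neq0 // gt_eqF.
Qed.

(** The letter at the tie can be chosen in two ways and all the others are
    forced. The two points differ by a single nonzero term of their series. *)
Lemma one_tie_pair theta k : tie (n := n) (k%:R * phi - theta) ->
  (forall k', tie (n := n) (k'%:R * phi - theta) -> k' = k) ->
  exists w0 w1, [/\ w0 <> w1, W n c theta = [set w0; w1] &
    address c unit_root w0 <> address c unit_root w1].
Proof.
move=> tk only.
have [w hw] := choice (exists_optimal (phi := phi) n0 theta).
have [j0 [j1 [j01 jP e0 e1]]] := pair_optimal n0 hphi n1 tk.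
pose upd j := update w k j.
have updk j : upd j k = j by rewrite /upd /update eqxx.
have updn j i : i != k -> upd j i = w i by rewrite /upd /update => /negPf ->.
exists (upd j0), (upd j1); split.
- by move=> /(congr1 (@^~ k)); rewrite !updk => /eqP; rewrite (negPf j01).
- rewrite (extreme_wordsE n0 hc0 c1 hphi); apply/seteqP; split=> w' /=.
    move=> h; have w'n i : i != k -> w' i = w i.
      move=> ik; have nt : ~ tie (n := n) (i%:R * phi - theta).
        by move=> /only /eqP; apply/negP.
      have [j hj] := unique_optimal n0 nt.
      by rewrite ((hj _).1 (h i)) ((hj _).1 (hw i)).
    have upE j : w' k = j -> w' = upd j.
      move=> wk; apply/funext => i; have [->|ik] := eqVneq i k.
        by rewrite updk.
      by rewrite updn ?w'n.
    by have [/upE ->|/upE ->] := (jP _).1 (h k); [left|right].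
  have opt j : optimal (phi := phi) theta k j -> forall i, optimal (phi := phi) theta i (upd j i).
    by move=> oj i; have [->|ik] := eqVneq i k; [rewrite updk|rewrite updn].
  by move=> [->|->]; apply: opt; apply/jP; [left|right].
have uM := finite_bound (@unit_root R n).
move=> /(congr1 (fun z => z - address c unit_root w)).
rewrite !(address_update c1 uM) !mulrBr => /addIr /eqP; apply/negP.
exact: pair_optimal_neq e0 e1.
Qed.

End FewTies.

(** * Multiples of an irrational number modulo 1 *)

Section Irrational.
Context {R : realType}.
Implicit Types (phi a b e : R).

Lemma irrational_mul phi (a z : int) (n : nat) : irrational phi -> (0 < n)%N ->
  a%:~R * phi = z%:~R / n%:R -> a = 0.
Proof.
move=> irr n0 h; apply/eqP; apply/negP => /negP a0; apply: irr.
have nR : n%:R != 0 :> R by rewrite pnatr_eq0 -lt0n.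
have aR : a%:~R != 0 :> R by rewrite intr_eq0.
have -> : phi = z%:~R / n%:R / a%:~R by rewrite -h mulrC mulKf.
apply/rationalP; case: a {h a0} aR => k aR.
  by exists z, (n * k)%N; rewrite natrM invfM mulrA.
exists (- z), (n * k.+1)%N; rewrite natrM NegzE rmorphN /= mulrNz; field.
by rewrite nR nat1r pnatr_eq0.
Qed.

(** Pigeonhole: the fractional parts of the first N + 1 multiples of [phi] lie
    in N boxes of length 1/N. *)
Lemma small_multiple phi e : irrational phi -> 0 < e ->
  exists (d : nat) (m : int), (0 < d)%N /\ 0 < `|d%:R * phi - m%:~R| < e.
Proof.
move=> irr e0.
pose N := (Num.truncn e^-1).+1.
have N0 : 0 < N%:R :> R by rewrite ltr0n.
have Ne : N%:R^-1 < e by rewrite invf_plt ?posrE // truncnS_gt.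
pose fr (k : nat) : R := k%:R * phi - (Num.floor (k%:R * phi))%:~R.
have fr0 k : 0 <= fr k by rewrite subr_ge0 floor_le_tmp.
have fr1 k : fr k < 1 by rewrite ltrBlDr addrC -intrD1 floorD1_gt.
have lt (k : nat) : (Num.truncn (N%:R * fr k) < N)%N.
  by rewrite truncn_lt_nat ?mulr_ge0 ?(ltW N0) // gtr_pMr.
pose box (k : 'I_N.+1) : 'I_N := Ordinal (lt k).
have close (i j : 'I_N.+1) : (i < j)%N -> box i = box j ->
    exists (d : nat) (m : int), (0 < d)%N /\ 0 < `|d%:R * phi - m%:~R| < e.
  move=> lij /(congr1 val) /= bE; exists (j - i)%N.
  exists (Num.floor (j%:R * phi) - Num.floor (i%:R * phi)).
  rewrite subn_gt0; split => //; apply/andP; split.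
    rewrite normr_gt0 subr_eq0; apply/eqP => h.
    have := @irrational_mul phi (j - i)%N (Num.floor (j%:R * phi) - Num.floor (i%:R * phi)) 1 irr isT.
    by rewrite divr1 => /(_ h) /eqP; rewrite eqz_nat subn_eq0 leqNgt lij.
  rewrite natrB ?(ltnW lij) // rmorphB /=.
  have -> : (j%:R - i%:R) * phi - ((Num.floor (j%:R * phi))%:~R -
     (Num.floor (i%:R * phi))%:~R) = fr j - fr i by rewrite /fr; ring.
  apply: lt_trans Ne.
  have /andP[a1 a2] := truncn_itv (mulr_ge0 (ltW N0) (fr0 i)).
  have /andP[b1 b2] := truncn_itv (mulr_ge0 (ltW N0) (fr0 j)).
  rewrite bE in a1 a2.
  rewrite -(ltr_pM2l N0) mulfV ?gt_eqF // -[X in X * `|_|](gtr0_norm N0) -normrM.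
  rewrite -natr1 in a2 b2.
  by rewrite mulrBr ltr_norml; apply/andP; split; lra.
have /injectivePn[i [j ij bij]] : ~~ injectiveb box.
  by apply/negP => /injectiveP /leq_card; rewrite !card_ord ltnn.
have [lij|lij|eij] := ltngtP i j; [exact: close bij|exact: close (esym bij)|].
by move: ij; rewrite (val_inj eij) eqxx.
Qed.

(** Kronecker: walk with the small steps of [small_multiple]. *)
Lemma multiples_dense phi a b : irrational phi -> a < b ->
  exists (k : nat) (m : int), a < k%:R * phi + m%:~R < b.
Proof.
move=> irr ab.
have ba0 : 0 < b - a by rewrite subr_gt0.
have [d [m [d0 /andP[de0 de1]]]] := small_multiple irr ba0.
set de := d%:R * phi - m%:~R in de0 de1.
(* stepping by [e] from 0 cannot jump over an interval of length above [e] *)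
have step e x y : 0 < e -> e < y - x -> 0 <= x -> exists t : nat, x < t%:R * e < y.
  move=> e0 exy x0; exists (Num.truncn (x / e)).+1.
  have /andP[h1 h2] := truncn_itv (divr_ge0 x0 (ltW e0)).
  rewrite ler_pdivlMr // in h1; rewrite ltr_pdivrMr // in h2.
  by rewrite h2 /= -natr1 mulrDl mul1r; lra.
(* shifting by [M] makes the walk start before the interval, in either direction *)
have [M hM] : exists M : int, 0 <= a + M%:~R /\ 0 <= M%:~R - b.
  exists ((Num.truncn `|a|).+1 + (Num.truncn `|b|).+1)%N%:Z.
  have h1 := truncnS_gt `|a|; have h2 := truncnS_gt `|b|.
  rewrite -pmulrn natrD.
  have h3 := ler_norm (- a); rewrite normrN in h3; have h4 := ler_norm b.
  have : 0 <= (Num.truncn `|a|).+1%:R :> R by [].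
  have : 0 <= (Num.truncn `|b|).+1%:R :> R by [].
  by split; lra.
have [p0|p0] := ltrP 0 de.
  rewrite (gtr0_norm p0) in de1.
  have [|//|t ht] := step de (a + M%:~R) (b + M%:~R) p0; [lra|by case: hM|].
  exists (t * d)%N, (- (t%:Z * m) - M).
  rewrite natrM rmorphB rmorphN rmorphM /= -pmulrn.
  by rewrite /de in ht; lra.
have p1 : 0 < - de by rewrite oppr_gt0 lt_neqAle p0 -normr_eq0 gt_eqF.
rewrite (ler0_norm p0) in de1.
have [|//|t ht] := step (- de) (M%:~R - b) (M%:~R - a) p1; [lra|by case: hM|].
exists (t * d)%N, (- (t%:Z * m) + M).
rewrite natrM rmorphD rmorphN rmorphM /= -pmulrn.
by rewrite /de in ht; lra.
Qed.

Lemma closure_unit_itv (P : R -> Prop) :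
  (forall a b, a < b -> 0 <= a -> b <= 1 -> exists t, a < t < b /\ P t) ->
  `[0, 1] `<=` closure [set t | 0 <= t <= 1 /\ P t].
Proof.
move=> h x /=; rewrite in_itv /= => /andP[x0 x1] B /nbhs_ballP[e /= e0 eB].
have [|||t [/andP[at_ tb] Pt]] := h (Num.max 0 (x - e)) (Num.min 1 (x + e)).
- by rewrite gt_max !lt_min; apply/andP; split; apply/andP; split; lra.
- by rewrite le_max lexx.
- by rewrite ge_min lexx.
move: at_ tb; rewrite gt_max lt_min => /andP[t0 xt] /andP[t1 tx].
exists t; split; first by split => //; rewrite !ltW.
by apply: eB; rewrite /ball /= ltr_norml; apply/andP; split; lra.
Qed.

End Irrational.

(** * Irrational rotations *)

Section IrrationalRotation.
Context {R : realType} {n : nat} {c : R[i]} {phi : R}.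
Hypotheses (n1 : (1 < n)%N) (hc0 : 0 < normc c) (c1 : normc c < 1).
Hypothesis hphi : c = (normc c)%:C * cexp phi.
Hypothesis irr : irrational phi.
Implicit Types (theta : R).

Let n0 : (0 < n)%N := ltnW n1.

(** Two ties would make a nonzero multiple of [phi] rational. *)
Lemma tie_at_most_once theta k k' : tie (n := n) (k%:R * phi - theta) ->
  tie (n := n) (k'%:R * phi - theta) -> k' = k.
Proof.
move=> [m hm] [m' hm'].
suff /eqP : k'%:Z - k%:Z = 0 by rewrite subr_eq0 eqz_nat => /eqP.
apply: (@irrational_mul R phi _ (m' - m) n irr n0).
rewrite !rmorphB /= -!pmulrn !mulrBl.
have -> : k'%:R * phi = (k'%:R * phi - theta) + theta by ring.
have -> : k%:R * phi = (k%:R * phi - theta) + theta by ring.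
by rewrite hm hm'; ring.
Qed.

Lemma extreme_pair theta k : tie (n := n) (k%:R * phi - theta) ->
  exists w0 w1, [/\ w0 <> w1, W n c theta = [set w0; w1],
    address c unit_root w0 <> address c unit_root w1
    & E n c theta = [set address c unit_root w0; address c unit_root w1]].
Proof.
move=> tk; have [w0 [w1 [w01 We pn]]] :=
  one_tie_pair n1 hc0 c1 hphi tk (fun k' => @tie_at_most_once theta k k' tk).
exists w0, w1; split => //.
by rewrite (E_coding n0 c1) We image_setU !image_set1.
Qed.

Lemma irrational_cards theta : W n c theta #= E n c theta /\
  (E n c theta #= `I_1 \/ E n c theta #= `I_2).
Proof.
have [[k tk]|nt] := pselect (exists k, tie (n := n) (k%:R * phi - theta)).
  have [w0 [w1 [w01 We pn Ee]]] := extreme_pair tk.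
  have E2 : E n c theta #= `I_2 by rewrite Ee; exact: card_set2.
  split; last by right.
  by rewrite (card_eqr E2) We; exact: card_set2.
have [k tk|w [We Ee]] := no_tie_singleton n1 hc0 c1 hphi (theta := theta).
  by apply: nt; exists k.
by rewrite We Ee; split; [exact: eq_card1|left; exact: card_set1].
Qed.

(** At an angle s - phi with s rational, a tie at the place k would make
    (k + 1) phi rational. *)
Lemma dense_unique :
  `[0, 1] `<=` closure [set theta : R | 0 <= theta <= 1 /\ W n c theta #= `I_1].
Proof.
apply: closure_unit_itv => a b ab _ _.
have [|s] := @rat_in_itvoo R (a + phi) (b + phi); first by rewrite ltrD2r.
rewrite in_itv /= => /andP[s1 s2].
exists (ratr s - phi); split; first by apply/andP; split; lra.
have [k [m hm]|w [-> _]] := no_tie_singleton n1 hc0 c1 hphi (theta := ratr s - phi);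
  last exact: card_set1.
have [z [d [d0 sE]]] : exists (z : int) (d : nat), (0 < d)%N /\ ratr s = z%:~R / d%:R :> R.
  by have [z d _] := ratP s; exists z, d.+1; rewrite fmorph_div /= ratr_nat ratr_int.
suff : k.+1%:Z = 0 by [].
apply: (@irrational_mul R phi _ (d%:Z + 2 * m * d%:Z + 2 * n%:Z * z) (2 * n * d) irr).
  by rewrite !muln_gt0 n0 d0.
have dR : d%:R != 0 :> R by rewrite pnatr_eq0 -lt0n.
have nR : n%:R != 0 :> R by rewrite pnatr_eq0 -lt0n.
have -> : (k.+1%:Z)%:~R * phi = (k%:R * phi - (ratr s - phi)) + ratr s.
  by rewrite -pmulrn -natr1; ring.
rewrite hm sE !rmorphD !rmorphM /= -!pmulrn !natrM; field.
by rewrite dR nR.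
Qed.

(** The angles k phi + 1/(2n) have a tie at the place k. *)
Lemma dense_pair :
  `[0, 1] `<=` closure [set theta : R | 0 <= theta <= 1 /\ W n c theta #= `I_2].
Proof.
apply: closure_unit_itv => a b ab _ _.
have [|k [m /andP[h1 h2]]] := @multiples_dense R phi (a - (2 * n%:R)^-1) (b - (2 * n%:R)^-1) irr.
  by rewrite ltrD2r.
exists (k%:R * phi + m%:~R + (2 * n%:R)^-1); split.
  by apply/andP; split; lra.
have tk : tie (n := n) (k%:R * phi - (k%:R * phi + m%:~R + (2 * n%:R)^-1)).
  exists (- (m * n%:Z) - 1).
  have nR : n%:R != 0 :> R by rewrite pnatr_eq0 -lt0n.
  by rewrite rmorphB rmorphN rmorphM /= -pmulrn; field.
have [w0 [w1 [w01 -> _ _]]] := extreme_pair tk.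
exact: card_set2.
Qed.

(** In a convex set, an extreme pair of points would span a segment of extreme
    points. *)
Lemma irrational_not_convex : ~ convex (Lambda n c).
Proof.
move=> cL.
have tk : tie (n := n) (0%:R * phi - (- (2 * n%:R)^-1)).
  by exists 0; rewrite mul0r mul0r addr0 sub0r opprK.
have [w0 [w1 [_ _ pq Ee]]] := extreme_pair tk.
have /convexP := extreme_convex (theta := - (2 * n%:R)^-1) cL.
have -> : extreme_at (Lambda n c) (- (2 * n%:R)^-1) =
  E n c (- (2 * n%:R)^-1) by [].
rewrite Ee; set p := address _ _ w0; set q := address _ _ w1.
have half01 : 0 <= (2^-1 : R) <= 1 by lra.
move=> /(_ p q _ half01 (or_introl erefl) (or_intror erefl)).
have h2 : (1 - 2^-1 : R)%:C = (2^-1 : R)%:C by congr (_ %:C); lra.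
have twoE : (2^-1 : R)%:C + (2^-1 : R)%:C = 1.
  by rewrite -rmorphD (_ : 2^-1 + 2^-1 = 1 :> R) //; lra.
have half0 : (2^-1 : R)%:C != 0 by rewrite eq_complex /= eqxx andbT invr_eq0.
rewrite h2 => -[|] h; apply: pq.
- apply: (mulfI half0); apply: (@addrI _ ((2^-1 : R)%:C * p)).
  by rewrite h -mulrDl twoE mul1r.
- apply: (mulfI half0); apply: (@addIr _ ((2^-1 : R)%:C * q)).
  by rewrite h -mulrDl twoE mul1r.
Qed.

End IrrationalRotation.

(** * Addresses and weighted means *)

Section AddressTheory.
Context {R : realType} {J : Type}.
Variables (c : R[i]) (u : J -> R[i]) (M : R).
Hypotheses (c1 : normc c < 1) (uM : forall j, normc (u j) <= M).

(** Iterating the recursion m times leaves a remainder of norm at most |c|^m N.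
    Linear identities between address maps follow from this. *)
Lemma address_unique (F : (nat -> J) -> R[i]) N :
  (forall g, normc (F g) <= N) ->
  (forall g, F g = u (g 0%N) + c * F (fun k => g k.+1)) -> F = address c u.
Proof.
move=> FN Frec; apply/funext => g.
have Fsplit m : F g = \sum_(k < m) c ^+ k * u (g k) + c ^+ m * F (fun k => g (m + k)%N).
  elim: m => [|m IH]; first by rewrite big_ord0 add0r expr0 mul1r.
  rewrite {}IH big_ord_recr /= -addrA; congr (_ + _).
  rewrite Frec addn0 mulrDr mulrA -exprSr; congr (_ + _ * F _).
  by apply/funext => k; rewrite addnS.
apply/esym/cvgc_lim/cvgcnP => e e0.
have /cvgrPdist_lt h : (fun m => normc c ^+ m * N) @ \oo --> 0.
  rewrite -[X in _ --> X](mul0r N); apply: cvgM; last exact: cvg_cst.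
  by apply: cvg_expr; rewrite ger0_norm ?normc_ge0.
have [m0 _ hm0] := h _ e0; exists m0 => m /hm0 /=; rewrite sub0r normrN.
apply: le_lt_trans; rewrite ler_normr; apply/orP; left.
rewrite (Fsplit m) addrAC subrr add0r normcM normcX.
by rewrite ler_wpM2l ?exprn_ge0 ?normc_ge0.
Qed.

Lemma address_const j : address c u (fun=> j) = u j / (1 - c).
Proof.
have c'0 : 1 - c != 0.
  rewrite subr_eq0; apply/eqP => c1'; move: c1; rewrite -c1'.
  by have := normc1 R; rewrite /= => ->; rewrite ltxx.
apply/(canRL (mulfK c'0)); rewrite mulrBr mulr1 [X in X - _](address_cons c1 uM).
by rewrite mulrC addrK.
Qed.

End AddressTheory.

Section AddressLinear.
Context {R : realType}.
Variable c : R[i].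
Hypothesis c1 : normc c < 1.

Lemma address_scale (J : finType) (u : J -> R[i]) x :
  address c (fun j => x * u j) = (fun g => x * address c u g).
Proof.
have uM := finite_bound u.
apply/esym/(@address_unique _ _ _ _ c1 _ (normc x * (\sum_j normc (u j) / (1 - normc c)))).
  move=> g; rewrite normcM ler_wpM2l ?normc_ge0 // -mulr_suml.
  exact: norm_address.
by move=> g; rewrite (address_cons c1 uM) mulrDr mulrCA.
Qed.

(** A point with address [g] is a weighted mean of the fixed points
    [u j / (1 - rho)]: the weight of [j] is [1 - rho] times the sum of
    [rho ^+ k] over the positions [k] of [j] in [g]. *)
Lemma address_in_convex (J : finType) (u : J -> R[i]) (rho : R) K g :
  0 <= rho < 1 -> convex K -> (forall j, K (u j / (1 - rho%:C))) ->
  K (address rho%:C u g).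
Proof.
move=> /andP[r0 r1] cK Ku.
have nr : normc rho%:C < 1 by rewrite normc_realC ger0_norm.
have r'0 : 1 - rho != 0 by rewrite subr_eq0 gt_eqF.
pose chi (j j' : J) : R[i] := ((j' == j)%:R : R)%:C.
have chiM (j j' : J) : normc (chi j j') <= 1.
  by rewrite /chi normc_realC; case: eqP; rewrite ?normr0 ?normr1 ?ler01.
pose wt (h : nat -> J) j := complex.Re (address rho%:C (chi j) h).
have wt_cons h j : wt h j = (h 0%N == j)%:R + rho * wt (fun k => h k.+1) j.
  rewrite /wt (address_cons nr (chiM j)) raddfD /=.
  by case: (address _ _ _) => x y /=; rewrite mul0r subr0.
have wtM h j : `|wt h j| <= 1 / (1 - rho).
  apply: le_trans (normc_Re _) _.
  by have := norm_address nr (chiM j) h; rewrite normc_realC ger0_norm.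
have wt0 h j : 0 <= wt h j.
  have lip (z w : R[i]) : `|complex.Re z - complex.Re w| <= normc (z - w).
    by rewrite -raddfB normc_Re.
  have cv := @cvg_lip R nat \oo eventually_filter _ _ (@complex.Re R) lip
    (cvg_address nr (chiM j) (g := h)).
  apply: (ler_cvg_to (cvg_cst 0) cv); apply: nearW => m /=.
  rewrite raddf_sum sumr_ge0 // => k _.
  by rewrite /chi -rmorphXn -rmorphM /= mulr_ge0 ?exprn_ge0.
have wt1 h : \sum_j wt h j = (1 - rho)^-1.
  have /(congr1 (@^~ h)) /= e1 :
      (fun h => (\sum_j wt h j)%:C) = address rho%:C (fun _ : J => 1).
    apply: (address_unique nr (N := \sum_(j : J) 1 / (1 - rho))).
      move=> h'; rewrite normc_realC (le_trans (ler_norm_sum _ _ _)) //.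
      by apply: ler_sum => j _; exact: wtM.
    move=> h'; rewrite -rmorphM -(rmorph1 (real_complex R)) -rmorphD /= mulr_sumr.
    congr _%:C; under eq_bigr do rewrite wt_cons.
    rewrite big_split /= (bigD1 (h' 0%N)) //= eqxx big1 ?addr0 // => j.
    by rewrite eq_sym => /negPf ->.
  apply: (@complexI R); rewrite e1.
  rewrite -[LHS]/(address rho%:C (fun _ : J => 1) (fun=> h 0%N)).
  rewrite (address_const (M := 1) nr); last by move=> _; rewrite normc1.
  by rewrite mul1r fmorphV rmorphB rmorph1.
have wtu : (fun h => \sum_j (wt h j)%:C * u j) = address rho%:C u.
  apply: (address_unique nr (N := \sum_j 1 / (1 - rho) * normc (u j))).
    move=> h; rewrite (le_trans (normc_sum _ _ _)) //; apply: ler_sum => j _.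
    by rewrite normcM normc_realC ler_wpM2r ?normc_ge0.
  move=> h; under eq_bigr do rewrite wt_cons rmorphD mulrDl.
  rewrite big_split /= (bigD1 (h 0%N)) //= eqxx mul1r big1 ?addr0.
    by congr (_ + _); rewrite mulr_sumr; apply: eq_bigr => j _; rewrite rmorphM mulrA.
  by move=> j; rewrite eq_sym => /negPf ->; rewrite mul0r.
rewrite -wtu.
have -> : \sum_j (wt g j)%:C * u j = \sum_j ((1 - rho) * wt g j)%:C * (u j / (1 - rho%:C)).
  apply: eq_bigr => j _; rewrite rmorphM rmorphB rmorph1 /=; field.
  by rewrite eq_complex /= negb_and r'0.
apply: convex_comb => //.
  by move=> j; rewrite mulr_ge0 // subr_ge0 ltW.
by rewrite -mulr_sumr wt1 mulfV.
Qed.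

End AddressLinear.

(** * Limit sets of two maps with a real ratio *)

Section TwoMaps.
Context {R : realType}.
Variables (rho : R) (u : 'I_2 -> R[i]).
Hypotheses (r0 : 0 < rho) (r1 : rho < 1) (u01 : u ord0 != u ord_max).

Local Notation A := (range (address rho%:C u)).
Local Notation x := (u ord0 / (1 - rho%:C)).
Local Notation y := (u ord_max / (1 - rho%:C)).

Let nr : normc rho%:C < 1.
Proof. by rewrite normc_realC gtr0_norm. Qed.

Let r'0 : 1 - rho%:C != 0 :> R[i].
Proof. by rewrite eq_complex /= negb_and subr_eq0 gt_eqF. Qed.

Let uM := finite_bound u.

Lemma ord2P (i : 'I_2) : i = ord0 \/ i = ord_max.
Proof. by case: i => [[|[|//]] ?]; [left|right]; exact/val_inj. Qed.

Lemma two_maps_neq : x != y.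
Proof. by rewrite (inj_eq (mulIf _)) // invr_eq0. Qed.

Lemma two_maps_left : A x.
Proof. by exists (fun=> ord0) => //; exact: (address_const nr uM). Qed.

Lemma two_maps_right : A y.
Proof. by exists (fun=> ord_max) => //; exact: (address_const nr uM). Qed.

Lemma two_maps_sub : A `<=` segment x y.
Proof.
move=> _ [g _ <-]; apply: address_in_convex; [by rewrite ltW|exact: segment_convex|].
by move=> j; case: (ord2P j) => ->; [exact: segment_left|exact: segment_right].
Qed.

Lemma two_maps_hull : convex_hull A = segment x y.
Proof. exact: (hull_segment two_maps_left two_maps_right two_maps_sub). Qed.

Lemma segment_coord_inj (s t : R) : (1 - s)%:C * x + s%:C * y = (1 - t)%:C * x + t%:C * y -> s = t.
Proof.
move=> h; apply: (@complexI R); apply/eqP; rewrite -subr_eq0.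
have yx : y - x != 0 by rewrite subr_eq0 eq_sym two_maps_neq.
rewrite -(mulIr_eq0 _ (mulIf yx)); apply/eqP.
have -> : (s%:C - t%:C) * (y - x) =
  ((1 - s)%:C * x + s%:C * y) - ((1 - t)%:C * x + t%:C * y).
  by rewrite !rmorphB rmorph1; ring.
by rewrite h subrr.
Qed.

(** The tail of an address lies on the segment, so that the point lies on the
    copy of the segment shrunk by [rho] towards the end of the first letter. *)
Lemma address_coord g : exists s : R, [/\ 0 <= s <= 1,
  address rho%:C u g = (1 - s)%:C * x + s%:C * y,
  g 0%N = ord0 -> s <= rho & g 0%N = ord_max -> 1 - rho <= s].
Proof.
have /segmentP[t /andP[t0 t1] tE] : segment x y (address rho%:C u (fun k => g k.+1)).
  by apply: two_maps_sub; eexists.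
have uE j : u j = (1 - rho%:C) * (u j / (1 - rho%:C)) by rewrite mulrC divfK.
rewrite (address_cons nr uM) tE.
have rt0 : 0 <= rho * t by rewrite mulr_ge0 // ltW.
have rt1 : rho * t <= rho by rewrite ler_piMr // ltW.
have c0 : 0 <= rho * t <= 1 by rewrite rt0 (le_trans rt1) // ltW.
have c1 : 0 <= 1 - rho * (1 - t) <= 1.
  rewrite mulrBr mulr1; set p := rho * t in rt0 rt1 *.
  by move: (r1) => lt1; apply/andP; split; lra.
case: (ord2P (g 0%N)) => ->; [exists (rho * t)|exists (1 - rho * (1 - t))]; split => //.
- by rewrite {1}uE !(rmorphB, rmorphM, rmorph1) /=; ring.
- by rewrite {1}uE !(rmorphB, rmorphM, rmorph1) /=; ring.
- by move=> _; rewrite lerD2l lerN2 ler_piMr ?(ltW r0) // gerBl.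
Qed.

(** For rho >= 1/2 the two shrunk copies of the segment cover it. *)
Lemma two_maps_segment : 2^-1 <= rho -> A = segment x y.
Proof.
move=> r2; apply/seteqP; split; first exact: two_maps_sub.
apply: (covered_address nr (N := normc x + normc y)).
  move=> z /segmentP[t /andP[t0 t1] ->]; rewrite (le_trans (le_normcD _ _)) //.
  rewrite (normcM (1 - t)%:C) (normcM t%:C) !normc_realC !ger0_norm ?subr_ge0 //.
  by rewrite lerD // ler_piMl ?normc_ge0 // gerBl.
have rC : rho%:C != 0 :> R[i] by rewrite eq_complex /= negb_and gt_eqF.
have uE j : u j = (1 - rho%:C) * (u j / (1 - rho%:C)) by rewrite mulrC divfK.
move=> z /segmentP[t /andP[t0 t1] ->].
have [tr|rt] := lerP t rho.
  exists ord0, ((1 - t / rho)%:C * x + (t / rho)%:C * y); split.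
    apply/segmentP; exists (t / rho) => //.
    by rewrite divr_ge0 ?(ltW r0) //= ler_pdivrMr // mul1r.
  have tE : t%:C = (t / rho)%:C * rho%:C :> R[i] by rewrite -rmorphM /= divfK ?gt_eqF.
  by rewrite [X in _ = _ + X]uE !rmorphB rmorph1 /= tE; ring.
pose s := (t - (1 - rho)) / rho.
exists ord_max, ((1 - s)%:C * x + s%:C * y); split.
  apply/segmentP; exists s => //; rewrite /s.
  by rewrite divr_ge0 ?(ltW r0) //=; [rewrite ler_pdivrMr // mul1r; lra|lra].
have tE : t%:C = s%:C * rho%:C + (1 - rho%:C) :> R[i].
  rewrite -(rmorph1 (real_complex R)) -rmorphM -rmorphB -rmorphD /=; congr _%:C.
  by rewrite /s; field; rewrite gt_eqF.
by rewrite [X in _ = _ + X]uE !rmorphB rmorph1 /= tE; ring.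
Qed.

(** A convex set contains the midpoint, which must lie on a shrunk copy. *)
Lemma two_maps_convex : convex A -> 2^-1 <= rho.
Proof.
have half01 : 0 <= (2^-1 : R) <= 1 by lra.
move=> /convexP /(_ _ _ _ half01 two_maps_left two_maps_right)[g _ gE].
have [s [_ sE h0 h1]] := address_coord g.
rewrite sE in gE; have s2 := segment_coord_inj gE.
by case: (ord2P (g 0%N)) => [/h0|/h1]; rewrite s2; lra.
Qed.

(** For rho < 1/2 the two shrunk copies of the segment are disjoint, so that the
    point determines the first letter in which two addresses differ. *)
Lemma address_inj : rho < 2^-1 -> injective (address rho%:C u).
Proof.
move=> r2 g g' gg'.
have [/ex_minnP[k kP kmin]|same] := pselect (exists k, g k != g' k); last first.
  by apply/funext => k; apply/eqP/negPn/negP => gk; apply: same; exists k.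
have pre i : (i < k)%N -> g i = g' i.
  by move=> ik; apply/eqP/negPn/negP => /kmin; rewrite leqNgt ik.
move: gg'; rewrite (address_split nr uM g k) (address_split nr uM g' k).
under eq_bigr => i _ do rewrite pre //.
move=> /addrI /mulfI tl.
have {}tl := tl _; rewrite expf_neq0 in tl; last by rewrite eq_complex /= negb_and gt_eqF.
have {}tl := tl isT.
have [s [_ sE h0 h1]] := address_coord (fun i => g (k + i)%N).
have [t [_ tE h0' h1']] := address_coord (fun i => g' (k + i)%N).
move: tl; rewrite sE tE => /segment_coord_inj st.
rewrite !addn0 in h0 h1 h0' h1'.
case: (ord2P (g k)) => gk; case: (ord2P (g' k)) => g'k.
- by rewrite gk g'k eqxx in kP.
- by exfalso; have := h0 gk; have := h1' g'k; rewrite st; lra.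
- by exfalso; have := h1 gk; have := h0' g'k; rewrite st; lra.
- by rewrite gk g'k eqxx in kP.
Qed.

(** The address map is a continuous injection of a compact space into a
    Hausdorff space, hence a homeomorphism onto its image. *)
Lemma two_maps_cantor : rho < 2^-1 -> is_cantor_set A.
Proof.
move=> r2; pose o (b : bool) : 'I_2 := if b then ord_max else ord0.
have oI : injective o by case; case.
pose f : cantor_space -> R[i] := fun g => address rho%:C u (fun k => o (g k)).
have fI : injective f.
  by move=> g g' /(address_inj r2) h; apply/funext => k; apply: oI; have := congr1 (@^~ k) h.
have fc : continuous f.
  exact: (@address_continuous _ _ nr bool (u \o o) _ (fun b => uM (o b))).
have fA : range f = A.
  apply/seteqP; split; first by move=> _ [g _ <-]; eexists.
  move=> _ [g _ <-]; exists (fun k => g k == ord_max) => //.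
  rewrite /f; congr address; apply/funext => k; rewrite /o.
  by case: (ord2P (g k)) => ->.
pose gi (z : R[i]) : cantor_space := xget (fun=> false) [set w | f w = z].
have fgi : cancel f gi.
  by move=> w; apply: fI; apply: (@xgetPex _ _ [set w' | f w' = f w]); exists w.
exists f, gi; split => //.
rewrite -fA; apply/continuous_closedP => B cB; apply/closed_subspaceP.
exists (f @` B).
  apply: compact_closed; first exact: norm_hausdorff.
  apply: continuous_compact; first exact: continuous_subspaceT.
  exact: (subclosed_compact cB cantor_space_compact).
apply/seteqP; split=> z /=.
  by move=> [[w Bw <-] _]; split; [exact: (eq_ind_r B Bw (fgi w))|exists w].
by move=> [Bz [w _ wz]]; split; [exists w => //; rewrite -(fgi w) wz|exists w].
Qed.

Lemma two_maps_conjugate :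
  conjugate_ifs (fun i z => rho%:C * z + u i) (root_ifs 2 rho%:C).
Proof.
have d0 : u ord0 - u ord_max != 0 by rewrite subr_eq0.
(* [a] maps the difference of the translations to 1 - (-1), and the constant
   term then matches the first translation with 1 *)
pose a := 2 / (u ord0 - u ord_max).
exists a, ((1 - a * u ord0) / (1 - rho%:C)), (1%g : {perm 'I_2}); split.
  by rewrite mulf_neq0 // ?invr_eq0 // pnatr_eq0.
move=> i z; rewrite perm1 /root_ifs cexp_half.
have -> : (-1) ^+ i = 1 - a * u ord0 + a * u i :> R[i].
  case: (ord2P i) => ->; first by rewrite subrK.
  by rewrite /= expr1 /a; field.
by field.
Qed.

Lemma two_maps_limit_set : limit_set (fun i z => rho%:C * z + u i) = A.
Proof. exact: limit_set_address. Qed.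

End TwoMaps.

(** * Rational rotations *)

Section RationalRotation.
Context {R : realType} {n : nat} {c : R[i]} {phi : R} {p : int} {q b : nat}.
Hypotheses (n1 : (1 < n)%N) (hc0 : 0 < normc c) (c1 : normc c < 1).
Hypothesis hphi : c = (normc c)%:C * cexp phi.
Hypotheses (q0 : (0 < q)%N) (pq : coprime `|p|%N q) (phiE : phi = p%:~R / q%:R).
Hypotheses (b0 : (0 < b)%N) (bn : (b * n)%N = lcmn n q).
Implicit Types (theta : R).

Let n0 : (0 < n)%N := ltnW n1.
Let nR : n%:R != 0 :> R. Proof. by rewrite pnatr_eq0 -lt0n. Qed.
Let qR : q%:R != 0 :> R. Proof. by rewrite pnatr_eq0 -lt0n. Qed.

Let rho : R := normc c ^+ b.
Let r0 : 0 < rho. Proof. exact: exprn_gt0. Qed.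
Let r1 : rho < 1. Proof. by rewrite exprn_ilt1 ?normc_ge0 // -lt0n. Qed.
Let nr : normc rho%:C < 1. Proof. by rewrite normc_realC gtr0_norm. Qed.
Let r'0 : 1 - rho%:C != 0 :> R[i].
Proof. by rewrite eq_complex /= negb_and subr_eq0 gt_eqF. Qed.
Let uM := finite_bound (@unit_root R n).

(** Together with [order_phi_dvd]: [b] is the order of [phi] modulo 1/n. *)
Lemma order_phi : exists a : int, b%:R * phi = a%:~R / n%:R.
Proof.
have /dvdnP[m mE] : (q %| b * n)%N by rewrite bn dvdn_lcmr.
exists (p * m%:Z); rewrite phiE rmorphM /= -pmulrn.
have h : b%:R * n%:R = m%:R * q%:R :> R by rewrite -!natrM mE.
have -> : b%:R = m%:R * q%:R / n%:R :> R by rewrite -h mulfK.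
by field; rewrite qR nR.
Qed.

(** As p is coprime to q, a multiple d phi in (1/n)Z forces q to divide d n,
    hence lcm(n, q) = b n to divide d n. *)
Lemma order_phi_dvd (d z : int) : d%:~R * phi = z%:~R / n%:R -> (b %| `|d|)%N.
Proof.
rewrite phiE => h.
have {}h : (d * p * n%:Z)%:~R = (z * q%:Z)%:~R :> R.
  rewrite !rmorphM /= -!pmulrn.
  have -> : d%:~R * p%:~R * n%:R = d%:~R * (p%:~R / q%:R) * q%:R * n%:R :> R.
    by field.
  by rewrite h; field.
move/intr_inj/(congr1 absz): h; rewrite !abszM /= => h.
have qd : (q %| `|d| * n)%N.
  rewrite -(@Gauss_dvdr q `|p|%N) 1?coprime_sym // mulnA (mulnC `|p|%N) h.
  exact: dvdn_mull.
rewrite -(@dvdn_pmul2r n) // bn dvdn_lcm qd andbT; exact: dvdn_mull.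
Qed.

Lemma ThetaP theta : Theta n b phi theta <->
  exists2 l, (l < b)%N & tie (n := n) (l%:R * phi - theta).
Proof.
split=> [[l [m [k [lb mn ->]]]]|[l lb [m hm]]].
  exists l => //; exists (- m%:Z - 1 - k * n%:Z).
  by rewrite !rmorphB rmorphN rmorphM /= -!pmulrn; field.
have [j [k hj]] := residue n0 (- 1 - m).
exists l, j, (- k); split => //.
have -> : j%:R = (j%:Z)%:~R :> R by rewrite -pmulrn.
have -> : theta = l%:R * phi - (l%:R * phi - theta) by ring.
by rewrite hm hj rmorphD rmorphB rmorphM !rmorphN rmorph1 /= -!pmulrn; field.
Qed.

Lemma tie_mod theta k : tie (n := n) (k%:R * phi - theta) ->
  tie (n := n) ((k %% b)%:R * phi - theta).
Proof.
move=> [m hm]; have [a ha] := order_phi.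
exists (m - (k %/ b)%:Z * a).
have kE : k%:R = (k %/ b)%:R * b%:R + (k %% b)%:R :> R by rewrite -natrM -natrD -divn_eq.
have -> : (k %% b)%:R * phi - theta = (k%:R * phi - theta) - (k %/ b)%:R * (b%:R * phi).
  by rewrite kE; ring.
by rewrite hm ha rmorphB rmorphM /= -pmulrn; field.
Qed.

Lemma small_dvd_eq (l l' : nat) : (l < b)%N -> (l' < b)%N ->
  (b %| `|l%:Z - l'%:Z|)%N -> l = l'.
Proof.
move=> lb l'b h; have lt : (`|l%:Z - l'%:Z| < b)%N by lia.
have z : `|l%:Z - l'%:Z|%N = 0%N.
  by apply/eqP; move: h; apply: contraTT; rewrite -lt0n => /gtnNdvd ->.
lia.
Qed.

Lemma tie_uniq_mod theta l l' : (l < b)%N -> (l' < b)%N ->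
  tie (n := n) (l%:R * phi - theta) -> tie (n := n) (l'%:R * phi - theta) -> l' = l.
Proof.
move=> lb l'b [m hm] [m' hm'].
have h : (b %| `|l'%:Z - l%:Z|)%N.
  apply: (@order_phi_dvd _ (m' - m)); rewrite !rmorphB /= -!pmulrn !mulrBl.
  have -> : l'%:R * phi = (l'%:R * phi - theta) + theta by ring.
  have -> : l%:R * phi = (l%:R * phi - theta) + theta by ring.
  by rewrite hm hm'; ring.
exact: small_dvd_eq h.
Qed.

Lemma nTheta_singleton theta : ~ Theta n b phi theta ->
  exists w, W n c theta = [set w] /\ E n c theta = [set address c unit_root w].
Proof.
move=> nT; apply: (no_tie_singleton n1 hc0 c1 hphi) => k /tie_mod tk.
by apply: nT; apply/ThetaP; exists (k %% b)%N => //; rewrite ltn_mod.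
Qed.

Lemma Theta0 : Theta n b phi ((2 * n%:R)^-1).
Proof. by apply/ThetaP; exists 0%N => //; exists (-1); rewrite mul0r rmorphN rmorph1; field. Qed.

Lemma rotate_letter (a : int) : exists s : 'I_n -> 'I_n,
  forall j, exists z : int, (s j)%:Z = j%:Z + a + z * n%:Z.
Proof.
by have [s hs] := choice (fun j : 'I_n => residue n0 (j%:Z + a)); exists s.
Qed.

(** As [c ^+ b] is [rho] times an n-th root of unity, a term that comes [b]
    places later is the same term scaled by [rho], up to a permutation [s] of the
    letters. *)
Lemma next_block : exists s s' : 'I_n -> 'I_n, [/\ cancel s' s,
  forall j, c ^+ b * unit_root j = rho%:C * unit_root (s j) &
  forall theta k j, gain (phi := phi) theta (b + k) j = gain (phi := phi) theta k (s j)].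
Proof.
have [a ha] := order_phi.
have [s hs] := rotate_letter a; have [s' hs'] := rotate_letter (- a).
have sE j : exists z : int, (s j)%:R / n%:R = (j%:R / n%:R + a%:~R / n%:R) + z%:~R :> R.
  have [k hk] := hs j; exists k.
  have -> : (s j)%:R = ((s j)%:Z)%:~R :> R by rewrite -pmulrn.
  by rewrite hk !rmorphD rmorphM /= -!pmulrn; field.
exists s, s'; split.
- move=> j; have [z hz] := hs (s' j); have [z' hz'] := hs' j.
  by apply: (@residue_inj _ _ _ (z + z')); rewrite hz hz'; ring.
- move=> j; rewrite (digitE hphi) root_cexp ha.
  by have [z ->] := sE j; rewrite cexpDint addrC.
move=> theta k j; rewrite /gain; have [z ->] := sE j.
rewrite (natrD _ b k) (mulrDl b%:R) ha addrA cosDint; congr (cos (_ * _)).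
by rewrite !addrA; ring.
Qed.

Definition block (f : {ffun 'I_b -> 'I_n}) : R[i] := \sum_(l < b) c ^+ l * unit_root (f l).

Lemma address_shift (s : 'I_n -> 'I_n) :
  (forall j, c ^+ b * unit_root j = rho%:C * unit_root (s j)) ->
  forall w, address c unit_root w = \sum_(k < b) c ^+ k * unit_root (w k) +
    rho%:C * address c unit_root (fun k => s (w (b + k)%N)).
Proof.
move=> sE w; rewrite (address_split c1 uM w b); congr (_ + _).
have e1 := address_scale c1 (@unit_root R n) (c ^+ b).
have e2 := address_scale c1 (fun j => unit_root (s j) : R[i]) rho%:C.
have h : (fun j => c ^+ b * unit_root j) = (fun j => rho%:C * unit_root (s j)) :> ('I_n -> R[i]).
  exact/funext.
rewrite h in e1; have /(congr1 (@^~ (fun k => w (b + k)%N))) /= <- := e1.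
by rewrite e2.
Qed.

Lemma address_prepend (s s' : 'I_n -> 'I_n) : cancel s' s ->
  (forall j, c ^+ b * unit_root j = rho%:C * unit_root (s j)) ->
  forall x w, address c unit_root (fun k => if (k < b)%N then x k else s' (w (k - b)%N)) =
    \sum_(k < b) c ^+ k * unit_root (x k) + rho%:C * address c unit_root w.
Proof.
move=> ss' sE x w; rewrite (address_shift sE); congr (_ + _ * _).
  by apply: eq_bigr => k _; rewrite ltn_ord.
congr address; apply/funext => k.
by rewrite ltnNge leq_addr /= addKn ss'.
Qed.

Lemma Lambda_compact : compact (Lambda n c).
Proof. by rewrite LambdaE //; exact: address_compact. Qed.

(** Cutting words into blocks of length [b] makes the limit set that of a system
    with the real ratio [rho], to which [address_in_convex] applies. *)
Lemma Lambda_block : Lambda n c = range (address rho%:C block).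
Proof.
have [s [s' [ss' sE _]]] := next_block.
apply/seteqP; split.
  have [N _ LN] := compactc_bounded Lambda_compact.
  apply: (covered_address nr LN); rewrite LambdaE // => _ [w _ <-].
  exists [ffun l : 'I_b => w l], (address c unit_root (fun k => s (w (b + k)%N))).
  split; first by eexists.
  rewrite (address_shift sE) addrC; congr (_ + _).
  by apply: eq_bigr => l _; rewrite ffunE.
apply: (address_closed nr (finite_bound block)).
- by rewrite LambdaE //; exists (address c unit_root (fun=> Ordinal n0)); eexists.
- apply: compact_closed; [exact: norm_hausdorff|exact: Lambda_compact].
move=> f z; rewrite LambdaE // => -[w _ <-].
exists (fun k => if (k < b)%N then
  (if insub k is Some l then f l else Ordinal n0) else s' (w (k - b)%N)) => //.
rewrite (address_prepend ss' sE) addrC; congr (_ + _).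
apply: eq_bigr => l _; congr (_ * unit_root _).
by rewrite valK.
Qed.

Lemma E_closed theta : closed (E n c theta).
Proof.
have [[p0 [Lp0 p0max]]|ne] := pselect (E n c theta !=set0); last first.
  by move/set0P/negP/negPn/eqP: ne => ->; exact: closed0.
have -> : E n c theta = Lambda n c `&` v theta @^-1` [set v theta p0].
  apply/seteqP; split=> z.
    by move=> [Lz zmax]; split => //=; apply/eqP; rewrite eq_le p0max // zmax.
  by move=> [Lz /= vz]; split=> // z' Lz'; rewrite vz; exact: p0max.
apply: closedI; first by apply: compact_closed; [exact: norm_hausdorff|exact: Lambda_compact].
apply: closed_comp; last exact: closed_eq.
move=> z _; have h := @cvg_lip _ _ (nbhs z) (nbhs_filter z) id z _ (@v_lip R theta).
by apply: h.
Qed.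

(** At an angle of a tie, the extreme points are self-similar: the letter at
    the place of the tie is free, all others of the first block are forced, and
    the remaining blocks repeat this up to a rotation of the letters. *)
Lemma Theta_two_maps theta : Theta n b phi theta ->
  exists u : 'I_2 -> R[i], u ord0 != u ord_max /\
    E n c theta = range (address rho%:C u).
Proof.
move=> /ThetaP[l lb tl].
have [s [s' [ss' sE sgain]]] := next_block.
have [w0 hw0] := choice (exists_optimal (phi := phi) n0 theta).
have [j0 [j1 [j01 jP e0 e1]]] := pair_optimal n0 hphi n1 tl.
pose jj (i : 'I_2) := if i == ord0 then j0 else j1.
pose x i k := if k == l then jj i else w0 k.
pose u i : R[i] := \sum_(k < b) c ^+ k * unit_root (x i k).
have opt_s k j : optimal (phi := phi) theta (b + k) j -> optimal (phi := phi) theta k (s j).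
  by move=> h j'; rewrite -(ss' j') -!sgain; exact: h.
have opt_s' k j : optimal (phi := phi) theta k j -> optimal (phi := phi) theta (b + k) (s' j).
  by move=> h j'; rewrite !sgain ss'; exact: h.
have WP := extreme_wordsE n0 hc0 c1 hphi theta.
have EP := @E_coding R n c n0 c1 theta.
exists u; split.
  rewrite -subr_eq0 -sumrB (bigD1 (Ordinal lb)) //= big1 ?addr0.
    rewrite /x eqxx /jj eqxx /= subr_eq0.
    exact: (pair_optimal_neq n1 hc0 e0 e1).
  by move=> k; rewrite -val_eqE /= => /negPf kl; rewrite /x kl subrr.
apply/seteqP; split.
  have [N _ LN] := compactc_bounded Lambda_compact.
  apply: (covered_address nr (N := N)); first by move=> z [/LN].
  rewrite EP WP => _ [w wopt <-].
  have [i ij] : exists i, w l = jj i.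
    by have [h|h] := (jP _).1 (wopt l); [exists ord0|exists ord_max].
  exists i, (address c unit_root (fun k => s (w (b + k)%N))); split.
    by exists (fun k => s (w (b + k)%N)) => // k; exact: opt_s.
  rewrite (address_shift sE) addrC; congr (_ + _).
  apply: eq_bigr => k _; congr (_ * unit_root _); rewrite /x.
  have [->//|kl] := eqVneq (k : nat) l.
  have nt : ~ tie (n := n) (k%:R * phi - theta).
    move=> tk; move/eqP: kl; apply.
    exact: tie_uniq_mod tl tk.
  by have [j hj] := unique_optimal n0 nt; rewrite ((hj _).1 (wopt k)) ((hj _).1 (hw0 k)).
apply: (address_closed nr (finite_bound u)); last 1 first.
- move=> i z; rewrite EP WP => -[w wopt <-].
  exists (fun k => if (k < b)%N then x i k else s' (w (k - b)%N)); last first.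
    by rewrite (address_prepend ss' sE) addrC.
  move=> k /=; case: ltnP => kb; last by rewrite -{1}(subnKC kb); exact: opt_s'.
  rewrite /x; have [->|//] := eqVneq k l.
  by apply/jP; rewrite /jj; case: ifP; [left|right].
- by rewrite EP WP; exists (address c unit_root w0); exists w0.
- exact: E_closed.
Qed.

(** The extreme points at an angle of a tie inherit convexity, and the ratio of
    their two maps is then at least 1/2. *)
Lemma convex_ratio : convex (Lambda n c) -> 2 `^ (- b%:R^-1) <= normc c.
Proof.
move=> cL; have [u [u01 Eu]] := Theta_two_maps Theta0.
have := extreme_convex (theta := (2 * n%:R)^-1) cL.
rewrite -[extreme_at _ _]/(E n c _) Eu => /(two_maps_convex r0 r1 u01) r2.
have -> : normc c = rho `^ b%:R^-1.
  by rewrite /rho -powR_mulrn ?normc_ge0 // -powRrM mulfV ?powRr1 ?normc_ge0 // pnatr_eq0 -lt0n.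
rewrite powRN -powR_inv1 // -powRrM mulrC powRrM powR_inv1 //.
by apply: ge0_ler_powR; rewrite ?invr_ge0 ?nnegrE ?(ltW r0) //.
Qed.

(** The fixed point of the map of the block [f]. *)
Definition vertex (f : {ffun 'I_b -> 'I_n}) : R[i] := block f / (1 - rho%:C).

Lemma Lambda_vertex f : Lambda n c (vertex f).
Proof.
by rewrite Lambda_block; exists (fun=> f); rewrite // (address_const nr (finite_bound block)).
Qed.

Lemma Lambda_sub K : convex K -> (forall f, K (vertex f)) -> Lambda n c `<=` K.
Proof.
move=> cK KV; rewrite Lambda_block => _ [g _ <-].
by apply: address_in_convex; rewrite ?(ltW r0).
Qed.

Lemma hull_vertices : convex_hull (Lambda n c) = convex_hull (range vertex).
Proof.
apply/seteqP; split; (apply: hull_min; last exact: hull_convex).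
  apply: Lambda_sub; first exact: hull_convex.
  by move=> f; apply: hull_sub; exists f.
by move=> _ [f _ <-]; apply: hull_sub; exact: Lambda_vertex.
Qed.

Lemma Lambda_update (w : nat -> 'I_n) k (j : 'I_n) :
  Lambda n c (address c unit_root w + c ^+ k * (unit_root j - unit_root (w k))).
Proof.
rewrite LambdaE // -(address_update c1 uM) addrC subrK.
by eexists.
Qed.

Lemma unit_root0 : unit_root (Ordinal n0) = 1 :> R[i].
Proof. by rewrite /unit_root expr0. Qed.

(** For two letters, [b > 1] says that 2 phi is not an integer. *)
Lemma Im_ratio_neq0 : n = 2%N -> (1 < b)%N -> complex.Im c != 0.
Proof.
move=> n2 b2; rewrite hphi /= mul0r addr0 mulf_neq0 ?(gt_eqF hc0) //.
have nphi (z : int) : phi <> z%:~R / 2.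
  move=> h; have := @order_phi_dvd 1 z; rewrite n2 mul1r => /(_ h).
  by rewrite dvdn1 => /eqP b1; rewrite b1 in b2.
have [k hk] := nearest_int phi.
have -> : sin (2 * pi * phi) = sin (2 * pi * (phi - k%:~R)).
  by have /(congr1 (@complex.Im R)) := cexpDint (phi - k%:~R) k; rewrite subrK.
set t := phi - k%:~R in hk *.
have t0 : t != 0.
  apply/eqP => h; apply: (nphi (2 * k)); rewrite rmorphM /= -[LHS](subrK k%:~R) -/t h.
  by field.
have tp : t != 2^-1.
  apply/eqP => h; apply: (nphi (2 * k + 1)); rewrite rmorphD rmorphM /=.
  by rewrite -[LHS](subrK k%:~R) -/t h; field.
have tn : t != - 2^-1.
  apply/eqP => h; apply: (nphi (2 * k - 1)); rewrite rmorphB rmorphM /=.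
  by rewrite -[LHS](subrK k%:~R) -/t h; field.
have p0 := @pi_gt0 R.
move: hk; rewrite ler_norml !le_eqVlt (eq_sym (- _)) (negPf tn) (negPf tp) /=.
move=> /andP[lo hi]; move: t0; rewrite neq_lt => /orP[tlt|tgt].
  rewrite -oppr_eq0 -sinN gt_eqF // sin_gt0_pi //; apply/andP; split; nra.
by rewrite gt_eqF // sin_gt0_pi //; apply/andP; split; nra.
Qed.

(** Changing letters of a constant word moves its point in two independent
    directions: for at least three letters put two others at the place 0, for two
    letters put the other one at the place 0 or 1, which gives the directions 1
    and c. *)
Lemma hull_interior : (n * b)%N != 2%N -> (convex_hull (Lambda n c))° !=set0.
Proof.
move=> nb; pose i0 : 'I_n := Ordinal n0; pose i1 : 'I_n := Ordinal n1.
pose P := address c unit_root (fun=> i0).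
have up k (j : 'I_n) : convex_hull (Lambda n c) (P + c ^+ k * (unit_root j - unit_root i0)).
  by apply: hull_sub; exact: Lambda_update.
have P0 : convex_hull (Lambda n c) P by have := up 0%N i0; rewrite subrr mulr0 addr0.
have [n3|n2] := ltnP 2 n.
  pose i2 : 'I_n := Ordinal n3.
  apply: (triangle_interior (@hull_convex _ _) P0 (up 0%N i1) (up 0%N i2)).
  rewrite expr0 !mul1r unit_root0.
  have -> : unit_root i1 = cexp n%:R^-1 :> R[i] by rewrite /unit_root expr1.
  have -> : unit_root i2 = cexp n%:R^-1 * cexp n%:R^-1 :> R[i] by rewrite /unit_root expr2.
  have S0 : 0 < sin (2 * pi / n%:R) :> R.
    have nR3 : 2 < n%:R :> R by rewrite ltr_nat.
    apply: sin_gt0_pi; rewrite divr_gt0 ?mulr_gt0 ?pi_gt0 ?ltr0n //=.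
    by rewrite ltr_pdivrMr ?ltr0n // mulrC ltr_pM2l ?pi_gt0.
  have C1 : cos (2 * pi / n%:R) < 1 :> R.
    rewrite lt_neqAle cos_le1 andbT; apply/eqP => h.
    have := cos2Dsin2 (2 * pi / n%:R : R); rewrite h expr1n => /eqP.
    by rewrite -subr_eq0 addrAC subrr add0r expf_eq0 /= gt_eqF.
  have := cos2Dsin2 (2 * pi / n%:R : R); rewrite /cexp /=.
  set C := cos _ in C1 *; set S := sin _ in S0 * => CS.
  have -> : (C - 1) * (C * S + S * C - 0) - (S - 0) * (C * C - S * S - 1) =
      S * (C ^+ 2 + S ^+ 2) + S - 2 * C * S by ring.
  rewrite CS (_ : _ - _ = 2 * S * (1 - C)); last by ring.
  by rewrite !mulf_neq0 ?pnatr_eq0 ?gt_eqF // subr_gt0.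
have {}n2 : n = 2%N by apply/eqP; rewrite eqn_leq n2.
have b2 : (1 < b)%N by move: nb; rewrite n2; case: (b) b0 => [|[|]].
apply: (triangle_interior (@hull_convex _ _) P0 (up 0%N i1) (up 1%N i1)).
have -> : unit_root i1 - unit_root i0 = (- 2)%:C :> R[i].
  rewrite unit_root0 /unit_root /= expr1 n2 cexp_half.
  by rewrite rmorphN rmorphD rmorph1 /=; ring.
have := Im_ratio_neq0 n2 b2; rewrite expr0 mul1r expr1.
case: c => c' c'' /= h; rewrite !(mulr0, mul0r, add0r, subr0).
by rewrite mulf_neq0 ?oppr_eq0 ?mulf_neq0 ?oppr_eq0 ?pnatr_eq0.
Qed.

Lemma hull_degenerate : (n * b)%N = 2%N ->
  exists x y, x != y /\ convex_hull (Lambda n c) = segment x y.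
Proof.
move=> nb.
have n2 : n = 2%N by move: nb; case: (b) b0 => // b' _; nia.
have b1 : b = 1%N by move: nb; rewrite n2; lia.
pose i0 : 'I_n := Ordinal n0; pose i1 : 'I_n := Ordinal n1.
have l0 : (0 < b)%N by [].
have blockE f : block f = unit_root (f (Ordinal l0)).
  rewrite /block (bigD1 (Ordinal l0)) //= expr0 mul1r big1 ?addr0 // => i.
  by rewrite -val_eqE /= => i0'; have := ltn_ord i; rewrite {2}b1; case: (val i) i0'.
pose x := vertex [ffun=> i0]; pose y := vertex [ffun=> i1].
exists x, y; split.
  rewrite /x /y /vertex !blockE !ffunE (inj_eq (mulIf _)) ?invr_eq0 //.
  rewrite unit_root0 /unit_root /= expr1 n2 cexp_half.
  by rewrite -addr_eq0 -mulr2n pnatr_eq0.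
apply: hull_segment; [exact: Lambda_vertex..|].
apply: Lambda_sub; first exact: segment_convex.
move=> f; rewrite /vertex blockE.
have [->|->] : f (Ordinal l0) = i0 \/ f (Ordinal l0) = i1.
  case: (f _) => -[|[|m]] lt; [left|right|]; try exact/val_inj.
  by exfalso; rewrite n2 in lt.
  have -> : unit_root i0 / (1 - rho%:C) = x by rewrite /x /vertex blockE ffunE.
  exact: segment_left.
have -> : unit_root i1 / (1 - rho%:C) = y by rewrite /y /vertex blockE ffunE.
exact: segment_right.
Qed.

Lemma hull_polygon : (n * b)%N != 2%N -> polygon (convex_hull (Lambda n c)).
Proof.
move=> nb; split; last exact: hull_interior.
exists (range vertex); split; last exact: hull_vertices.
apply: finite_image; exact: finite_finset.
Qed.

(** By [extreme_hull] the face of the hull at an angle is the hull of the extreme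
    points at that angle: a segment at an angle of a tie, one point otherwise. *)
Lemma side_anglesE : side_angles (convex_hull (Lambda n c)) = Theta n b phi `&` `[0, 1[.
Proof.
apply/seteqP; split=> theta /=.
  move=> [t01 [x [y [xy sE]]]]; split; last by rewrite /= in_itv.
  apply: contrapT => /nTheta_singleton[w [_ Ew]].
  have h : extreme_at (convex_hull (Lambda n c)) theta = [set address c unit_root w].
    rewrite extreme_hull -[extreme_at _ _]/(E n c theta) Ew.
      by apply: hull_id; apply/convexP => a d t _ -> ->; rewrite -mulrDl -rmorphD subrK mul1r.
    by exists (address c unit_root w).
  have hx := segment_left x y; have hy := segment_right x y.
  rewrite -sE h in hx hy.
  by move/eqP: xy; apply; rewrite hx hy.
move=> [tT]; rewrite in_itv /= => t01; split => //.
have [u [u01 Eu]] := Theta_two_maps tT.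
have nx := two_maps_neq r1 u01.
do 2 eexists; split; first exact: nx.
rewrite extreme_hull -[extreme_at _ _]/(E n c theta) Eu.
  exact: two_maps_hull.
by exists (address rho%:C u (fun=> ord0)); eexists.
Qed.

Lemma Theta_shift theta (k : int) : Theta n b phi theta -> Theta n b phi (theta + k%:~R).
Proof.
move=> [l [m [z [lb mn ->]]]]; exists l, m, (z + k); split => //.
by rewrite rmorphD /= !addrA.
Qed.

(** Different pairs (l, m) give different angles modulo 1, because [b] is the
    order of [phi] modulo 1/n. Here k stands for the pair of its quotient and its
    remainder by [n]. *)
Lemma Theta_card : (Theta n b phi `&` `[0, 1[) #= `I_(n * b).
Proof.
pose t (k : nat) : R := (k %/ n)%:R * phi + (k %% n)%:R / n%:R + (2 * n%:R)^-1.
pose f (k : nat) : R := t k - (Num.floor (t k))%:~R.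
have -> : Theta n b phi `&` `[0, 1[ = f @` `I_(n * b).
  apply/seteqP; split=> theta /=.
    move=> [[l [m [z [lb mn thE]]]]]; rewrite in_itv /= => /andP[th0 th1].
    exists (l * n + m)%N.
      by have : (l.+1 * n <= n * b)%N; [rewrite mulnC leq_mul2l lb orbT|rewrite mulSn; lia].
    rewrite /f; have tE : t (l * n + m)%N = theta + (- z)%:~R.
      by rewrite /t divnMDl // modnMDl divn_small // modn_small // addn0 thE rmorphN /= addrK.
    rewrite tE (@Num.Theory.floor_def _ _ (- z)) ?addrK //.
    by rewrite rmorphD rmorph1 rmorphN /=; apply/andP; split; lra.
  move=> [k kn <-]; split.
    rewrite /f -rmorphN; apply: Theta_shift.
    exists (k %/ n)%N, (k %% n)%N, 0; split; [by rewrite ltn_divLR // mulnC|by rewrite ltn_mod|].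
    by rewrite addr0.
  have h1 := floor_le_tmp (t k); have h2 := floorD1_gt (t k).
  by rewrite in_itv /= /f; rewrite intrD in h2; apply/andP; split; lra.
apply: inj_card_eq => k k' /set_mem kn /set_mem kn' /= ff.
have lb : (k %/ n < b)%N by rewrite ltn_divLR // mulnC.
have lb' : (k' %/ n < b)%N by rewrite ltn_divLR // mulnC.
have [z tt] : exists z : int, t k - t k' = z%:~R.
  exists (Num.floor (t k) - Num.floor (t k')).
  by rewrite rmorphB /=; move: ff; rewrite /f; lra.
have ll : (k %/ n = k' %/ n)%N.
  have d : (b %| `|(k %/ n)%:Z - (k' %/ n)%:Z|)%N.
    apply: (@order_phi_dvd _ ((k' %% n)%:Z - (k %% n)%:Z + z * n%:Z)).
    by rewrite intrD intrM !rmorphB /= -!pmulrn -tt /t; field.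
  exact: small_dvd_eq d.
have mm : (k %% n = k' %% n)%N.
  have := @residue_inj n (Ordinal (ltn_pmod k n0)) (Ordinal (ltn_pmod k' n0)) z.
  move=> h; apply: (congr1 val (h _)) => /=.
  by apply: (@intr_inj R); rewrite intrD intrM /= -!pmulrn -tt /t ll; field.
by rewrite (divn_eq k n) ll mm -divn_eq.
Qed.

Lemma side_angles_card : side_angles (convex_hull (Lambda n c)) #= `I_(n * b).
Proof. by rewrite side_anglesE; exact: Theta_card. Qed.

End RationalRotation.

Theorem theorem4p1 (R : realType) (n : nat) (c : R[i]) (phi : R)
    (hn : (2 <= n)%N) (hc0 : 0 < normc c) (hc1 : normc c < 1)
    (hphi : c = (normc c)%:C * cexp phi) :
  (irrational phi ->
   [/\ forall theta : R, 0 <= theta <= 1 ->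
         W n c theta #= E n c theta /\
         (E n c theta #= `I_1 \/ E n c theta #= `I_2),
       `[0, 1] `<=` closure [set theta : R | 0 <= theta <= 1 /\ W n c theta #= `I_1],
       `[0, 1] `<=` closure [set theta : R | 0 <= theta <= 1 /\ W n c theta #= `I_2]
     & ~ convex (Lambda n c)]) /\
  (forall (p : int) (q b : nat),
   (0 < q)%N -> coprime `|p|%N q -> phi = p%:~R / q%:R ->
   (0 < b)%N -> (b * n)%N = lcmn n q ->
   [/\ forall theta : R, 0 <= theta <= 1 -> Theta n b phi theta ->
         [/\ exists G : 'I_2 -> R[i] -> R[i],
               conjugate_ifs G (root_ifs 2 ((normc c ^+ b)%:C)) /\
               E n c theta = limit_set G,
             normc c ^+ b < 2^-1 -> is_cantor_set (E n c theta)
           & 2^-1 <= normc c ^+ b ->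
             exists x y, x != y /\ E n c theta = segment x y],
       forall theta : R, 0 <= theta <= 1 -> ~ Theta n b phi theta ->
         W n c theta #= `I_1 /\ E n c theta #= `I_1,
       [/\ (n * b)%N != 2%N -> polygon (convex_hull (Lambda n c)),
           (n * b)%N = 2%N ->
             exists x y, x != y /\ convex_hull (Lambda n c) = segment x y,
           side_angles (convex_hull (Lambda n c)) = Theta n b phi `&` `[0, 1[
         & side_angles (convex_hull (Lambda n c)) #= `I_(n * b)]
     & convex (Lambda n c) -> 2 `^ (- b%:R^-1) <= normc c]).
Proof.
split=> [irr|p q b q0 pq phiE b0 bn].
  split; first by move=> theta _; exact: (irrational_cards hn hc0 hc1 hphi irr).
  - exact: (dense_unique hn hc0 hc1 hphi irr).
  - exact: (dense_pair hn hc0 hc1 hphi irr).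
  - exact: (irrational_not_convex hn hc0 hc1 hphi irr).
have rho0 : 0 < normc c ^+ b by exact: exprn_gt0.
have rho1 : normc c ^+ b < 1 by rewrite exprn_ilt1 ?normc_ge0 // -lt0n.
split.
- move=> theta _ tT.
  have [u [u01 ->]] := Theta_two_maps hn hc0 hc1 hphi q0 pq phiE b0 bn tT.
  split.
  + exists (fun i z => (normc c ^+ b)%:C * z + u i).
    by split; [exact: two_maps_conjugate|rewrite two_maps_limit_set].
  + exact: two_maps_cantor.
  + move=> rho2; exists (u ord0 / (1 - (normc c ^+ b)%:C)), (u ord_max / (1 - (normc c ^+ b)%:C)).
    by split; [exact: two_maps_neq|exact: two_maps_segment].
- move=> theta _ /(nTheta_singleton hn hc0 hc1 hphi q0 phiE b0 bn)[w [-> ->]].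
  by split; exact: card_set1.
- split.
  + exact: (hull_polygon hn hc0 hc1 hphi q0 pq phiE b0 bn).
  + exact: (hull_degenerate hn hc0 hc1 hphi q0 pq phiE b0 bn).
  + exact: (side_anglesE hn hc0 hc1 hphi q0 pq phiE b0 bn).
  + exact: (side_angles_card hn hc0 hc1 hphi q0 pq phiE b0 bn).
- exact: (convex_ratio hn hc0 hc1 hphi q0 pq phiE b0 bn).
Qed.
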